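(* Let $p\in(0,1]$ be fixed. With probability tending to $1$ as $N\to\infty$ (over the graph $G\sim\mathcal G(N,p)$, the initial partition and the randomness of the search), the greedy search for a local MINCUT of $G$, started from a uniformly random partition of $\{1,\dots,N\}$, terminates in the trivial partition $(\emptyset,\{1,\dots,N\})$.
   Context: $\mathcal G(N,p)$ is the Erdős–Rényi random graph on $\{1,\dots,N\}$ in which each edge is present independently with probability $p$. For $A\subset\{1,\dots,N\}$, $\mathrm{CUT}_G(A)$ is the number of edges of $G$ between $A$ and $A^c$. A local MINCUT is a partition $(A,A^c)$ such that $\mathrm{CUT}_G(A')\ge\mathrm{CUT}_G(A)$ for every $A'$ obtained from $A$ by adding or removing one vertex. Greedy search: start from a uniformly random partition $(A,A^c)$, i.e. each vertex is placed in $A$ or $A^c$ independently with probability $1/2$, independently of $G$. At every iteration, select a vertex uniformly at random and place it in $A$ or in $A^c$ according to which choice gives the lower value of $\mathrm{CUT}_G$; if the two cut values are equal, flip a fair coin to determine whether to move it. Partitions are considered unordered, so terminating in the trivial partition means that the search is eventually constant with $A=\emptyset$ or $A^c=\emptyset$. *)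

(* Defs.v *)
From HB Require Import structures.
From mathcomp Require Import all_boot all_order all_algebra.
From mathcomp Require Import all_classical all_reals all_analysis.

Set Implicit Arguments.
Unset Strict Implicit.
Unset Printing Implicit Defensive.

Import Order.TTheory GRing.Theory Num.Theory.
Import numFieldNormedType.Exports.

Record sgraph (N : nat) := SGraph {
  adj :> rel 'I_N;
  adj_sym : symmetric adj;
  adj_irrefl : irreflexive adj }.

(* Each edge between A and its complement is counted once, namely as the
   ordered pair whose first end is in A. *)
Definition CUT (N : nat) (G : sgraph N) (A : {set 'I_N}) : nat :=
  #|[set e : 'I_N * 'I_N | [&& e.1 \in A, e.2 \notin A & adj G e.1 e.2]]|.

Definition move (N : nat) (A : {set 'I_N}) (v : 'I_N) : {set 'I_N} :=
  if v \in A then A :\ v else v |: A.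

(* One iteration at the selected vertex v; the coin is only read when the two
   possible positions of v give the same cut value. *)
Definition greedy_step (N : nat) (G : sgraph N) (A : {set 'I_N})
    (v : 'I_N) (coin : bool) : {set 'I_N} :=
  if (CUT G (v |: A) < CUT G (A :\ v))%N then v |: A
  else if (CUT G (A :\ v) < CUT G (v |: A))%N then A :\ v
  else if coin then move A v else A.

Fixpoint greedy_search (N : nat) (G : sgraph N) (A0 : {set 'I_N})
    (v : nat -> 'I_N) (coin : nat -> bool) (t : nat) : {set 'I_N} :=
  if t is s.+1
  then greedy_step G (greedy_search G A0 v coin s) (v s) (coin s)
  else A0.

Definition terminates_trivially (N : nat) (G : sgraph N) (A0 : {set 'I_N})
    (v : nat -> 'I_N) (coin : nat -> bool) : Prop :=
  let A := greedy_search G A0 v coin in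
  exists t0 : nat,
    (A t0 = finset.set0 \/ ~: A t0 = finset.set0) /\
    (forall t : nat, (t0 <= t)%N -> A t = A t0).

Local Open Scope classical_set_scope.
Local Open Scope ring_scope.

(* F i is the sigma-algebra (here: of a discrete random variable) attached to
   the index i. *)
Definition mutually_independent (d : measure_display) (T : measurableType d)
    (R : realType) (P : probability T R) (I : choiceType)
    (F : I -> set (set T)) : Prop :=
  (forall i, F i `<=` measurable) /\
  forall (J : seq I) (E : I -> set T), uniq J ->
    (forall i, i \in J -> F i (E i)) ->
    P (\bigcap_(i in [set` J]) E i) = (\prod_(i <- J) P (E i))%E.

Definition events_of (T V : Type) (X : T -> V) : set (set T) :=
  preimage_set_system setT X setT.

(* Unordered pairs of distinct vertices, represented by increasing pairs. *)
Definition vpair (N : nat) := {e : 'I_N * 'I_N | (e.1 < e.2)%N}.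

Inductive source (N : nat) :=
  | EdgeAt of vpair N
  | InitAt of 'I_N
  | PickAt of nat
  | CoinAt of nat.

HB.instance Definition _ (N : nat) := gen_eqMixin (source N).
HB.instance Definition _ (N : nat) := gen_choiceMixin (source N).

Definition source_events (N : nat) (T : Type) (G : T -> sgraph N)
    (A0 : T -> {set 'I_N}) (v : nat -> T -> 'I_N) (coin : nat -> T -> bool)
    (s : source N) : set (set T) :=
  match s with
  | EdgeAt e => events_of (fun w => adj (G w) (val e).1 (val e).2)
  | InitAt i => events_of (fun w => i \in A0 w)
  | PickAt t => events_of (v t)
  | CoinAt t => events_of (coin t)
  end.

(* G is an Erdos-Renyi graph G(N, p), A0 a uniformly random set of vertices,
   v t and coin t the uniform vertex and the fair coin of iteration t, and all
   these choices are independent. *)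
Record greedy_model (R : realType) (p : R) (N : nat) (d : measure_display)
    (T : measurableType d) (P : probability T R) (G : T -> sgraph N)
    (A0 : T -> {set 'I_N}) (v : nat -> T -> 'I_N) (coin : nat -> T -> bool)
    : Prop := GreedyModel {
  model_independent : mutually_independent P (source_events G A0 v coin);
  model_edge : forall i j : 'I_N, (i < j)%N ->
    P [set w | adj (G w) i j] = p%:E;
  model_init : forall i : 'I_N, P [set w | i \in A0 w] = (2^-1)%:E;
  model_pick : forall (t : nat) (i : 'I_N),
    P [set w | v t w = i] = (N%:R^-1)%:E;
  model_coin : forall t : nat, P [set w | coin t w] = (2^-1)%:E }.

(* Main.v *)
Require Import Defs.
From mathcomp Require Import all_boot all_order all_algebra.
From mathcomp Require Import all_classical all_reals all_analysis.
From mathcomp Require Import ring lra zify.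

(** Putting v on the side of A costs the number of neighbours of v outside A,
    so the search is a majority dynamics: a selected vertex with strictly more
    neighbours in A than in its complement joins A.  Cuts are invariant under
    complement, so A may be taken to be the larger side of the initial
    partition.  Call a vertex unattracted by A when at most half of its
    neighbours are in A.  A uniformly selected vertex changes #|A| on average
    by at least (#|~: A| - #|unattracted G A|) / N, whatever the coins do,
    because coins only matter for unattracted vertices.  Write s for the square
    root of N.  The proof shows that this drift stays above a positive constant
    b as long as #|~: A| > p N / 8 and the imbalance has not fallen back
    (drift_of_regular), for three reasons.

    - The initial imbalance 2 #|A0| - N exceeds X s with probability at least
      1 - X - o(1), since no binomial coefficient of N exceeds 2^N / s
      (initial_spread).
    - For a fixed A0 with such an imbalance, a proportion larger than 1/2 of
      the vertices have an excess of at least 3/4 p X s neighbours in A0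
      (population_biased).  Indeed this excess is the sum of a positive shift
      and of the difference of two independent binomials with the same law; the
      latter is symmetric, has spread of order s, and so falls within order X s
      of 0 with probability bounded below (binomE_collision).  The number of
      such vertices concentrates because two vertices share a single edge
      (population_concentration).
    - The number of edges between two sets K and S is close to its mean for all
      K and S at once (bern_E_not_jumbled).  This uniformity is what handles the
      dependence of the later partitions on the graph.  During the first
      K' s steps the partition differs from A0 in few vertices, and all but few
      vertices keep the excess that they had (card_newly_unattracted).  After
      that the imbalance is a large multiple of s, and then any partition with
      this imbalance attracts all but few vertices (card_unattracted_jumbled).

    Given the drift, the exponential of minus the distance of #|A| to a linearly
    rising barrier is a supermartingale, so that with probability 1 - o(1) the
    barrier is not crossed before #|~: A| drops to p N / 8 (fail_prob_drift).
    From then on every vertex has most of its neighbours in A, each selected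
    vertex joins A for good, and N^2 further steps select every vertex
    (fail_prob_end).  All these estimates concern finitely many choices, whose
    joint law is a product law on a finite set (prob_fiber); probabilities are
    therefore finite sums until the very end. *)

Set Implicit Arguments.
Unset Strict Implicit.
Unset Printing Implicit Defensive.

Import Order.TTheory GRing.Theory Num.Theory.
Import numFieldNormedType.Exports.

Local Open Scope ring_scope.

(** * Independent Bernoulli variables *)

Lemma expR_le_quadratic (R : realType) (y : R) :
  y <= 2^-1 -> expR y <= 1 + y + 2 * y ^+ 2.
Proof.
move=> hy.
have h1 : 0 < 1 - y by lra.
have : expR y <= (1 - y)^-1.
  rewrite -[y]opprK expRN lef_pV2 ?posrE ?expR_gt0 ?opprK //.
  by apply: expR_ge1Dx.
move=> h; apply: (le_trans h).
rewrite -[leLHS]mul1r ler_pdivrMr //.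
have : 0 <= y ^+ 2 * (1 - 2 * y) by apply: mulr_ge0; [exact: sqr_ge0|lra].
rewrite !expr2; nra.
Qed.

Section Bernoulli.
Context (R : realType) (I : finType).
Implicit Types (p : R) (g : {ffun I -> bool}) (f : {ffun I -> bool} -> R).

Definition bern_wt p g : R := \prod_i (if g i then p else 1 - p).
(** Probabilities are finite sums throughout: an event b of independent Bernoulli(p)
    coordinates has probability bern_E p (fun g => (b g)%:R). *)
Definition bern_E p f : R := \sum_g bern_wt p g * f g.

Lemma bern_wt_ge0 p g : 0 <= p -> p <= 1 -> 0 <= bern_wt p g.
Proof. by move=> h0 h1; apply: prodr_ge0 => i _; case: ifP => _; lra. Qed.

Lemma bern_E_prod p (F : I -> bool -> R) :
  bern_E p (fun g => \prod_i F i (g i)) =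
  \prod_i (p * F i true + (1 - p) * F i false).
Proof.
rewrite /bern_E.
transitivity (\sum_(g : {ffun I -> bool})
    \prod_i ((if g i then p else 1 - p) * F i (g i))).
  by apply: eq_bigr => g _; rewrite big_split.
rewrite -(bigA_distr_bigA (fun i b => (if b then p else 1 - p) * F i b)).
by apply: eq_bigr => i _; rewrite big_bool.
Qed.

Lemma bern_E1 p : bern_E p (fun=> 1) = 1.
Proof.
have := bern_E_prod p (fun _ _ => 1).
under [X in bern_E p X]funext do rewrite big1 //.
by move=> ->; rewrite big1 // => i _; rewrite !mulr1 addrC subrK.
Qed.

Lemma bern_ED p f1 f2 : bern_E p (fun g => f1 g + f2 g) = bern_E p f1 + bern_E p f2.
Proof. by rewrite /bern_E -big_split; apply: eq_bigr => g _; rewrite mulrDr. Qed.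

Lemma bern_EZ p c f : bern_E p (fun g => c * f g) = c * bern_E p f.
Proof. by rewrite /bern_E big_distrr; apply: eq_bigr => g _; rewrite mulrCA. Qed.

Lemma bern_E_cst p c : bern_E p (fun=> c) = c.
Proof.
rewrite -[RHS]mulr1 -(bern_E1 p) -bern_EZ.
by congr bern_E; apply: funext => g; rewrite mulr1.
Qed.

Lemma bern_E_sum p (J : Type) (r : seq J) (P : pred J)
    (F : J -> {ffun I -> bool} -> R) :
  bern_E p (fun g => \sum_(j <- r | P j) F j g) =
  \sum_(j <- r | P j) bern_E p (F j).
Proof.
rewrite /bern_E exchange_big; apply: eq_bigr => g _.
by rewrite big_distrr.
Qed.

Lemma ler_bern_E p f1 f2 : 0 <= p -> p <= 1 ->
  (forall g, f1 g <= f2 g) -> bern_E p f1 <= bern_E p f2.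
Proof.
move=> h0 h1 h; apply: ler_sum => g _.
by apply: ler_wpM2l => //; apply: bern_wt_ge0.
Qed.

(** Exponential Markov inequality.  The factor of one coordinate is bounded by
    1 + 2 (lam a_i)^2, because g_i - p is centred and expR is below its quadratic
    majorant when lam |a_i| <= 1/2. *)
Lemma bern_chernoff p (a : I -> R) (lam s : R) : 0 <= p -> p <= 1 ->
  0 <= lam -> (forall i, lam * `|a i| <= 2^-1) ->
  bern_E p (fun g => (s <= \sum_i a i * ((g i)%:R - p))%R%:R) <=
  expR (- (lam * s) + 2 * lam ^+ 2 * \sum_i a i ^+ 2).
Proof.
move=> h0 h1 hl ha.
have step1 : bern_E p (fun g => (s <= \sum_i a i * ((g i)%:R - p))%R%:R) <=
    bern_E p (fun g => expR (- (lam * s)) *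
       \prod_i expR (lam * (a i * ((g i)%:R - p)))).
  apply: ler_bern_E => // g; rewrite -expR_sum -expRD.
  case: (lerP s) => hs; last by rewrite mulr0n expR_ge0.
  rewrite mulr1n -[leLHS]expR0 ler_expR -mulr_sumr addrC subr_ge0.
  exact: ler_wpM2l.
apply: (le_trans step1).
rewrite bern_EZ (bern_E_prod p (fun i b => expR (lam * (a i * (b%:R - p))))).
rewrite expRD ler_pM2l ?expR_gt0 // mulr_sumr expR_sum.
apply: ler_prod => i _; apply/andP; split.
  by rewrite addr_ge0 // mulr_ge0 ?expR_ge0 //; lra.
have [ha1 ha2] : lam * a i <= 2^-1 /\ - 2^-1 <= lam * a i.
  have := ha i; rewrite -{1}(ger0_norm hl) -normrM ler_norml => /andP[? ?]; split; lra.
set y := lam * a i in ha1 ha2 *.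
have e1 : expR (lam * (a i * (true%:R - p))) <= 1 + y * (1 - p) + 2 * (y * (1 - p)) ^+ 2.
  rewrite mulr1n mulrA -/y; apply: expR_le_quadratic.
  have : 0 <= (2^-1 - y) * (1 - p) by apply: mulr_ge0; lra.
  lra.
have e2 : expR (lam * (a i * (false%:R - p))) <= 1 - y * p + 2 * (y * p) ^+ 2.
  have -> : 1 - y * p + 2 * (y * p) ^+ 2 = 1 + y * - p + 2 * (y * - p) ^+ 2 by ring.
  rewrite mulrA -/y sub0r; apply: expR_le_quadratic.
  have : 0 <= (2^-1 + y) * p by apply: mulr_ge0; lra.
  lra.
apply: (@le_trans _ _ (1 + 2 * y ^+ 2)); last first.
  by apply: le_trans (expR_ge1Dx _); rewrite /y exprMn !mulrA.
have -> : 2 * y ^+ 2 =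
  2 * y ^+ 2 * (p * (1 - p)) +
  2 * y ^+ 2 * (p * p + (1 - p) * (1 - p) + p * (1 - p)) by ring.
have hy : 0 <= y ^+ 2 by exact: sqr_ge0.
have e1' := ler_wpM2l h0 e1.
have h1' : 0 <= 1 - p by lra.
have e2' := ler_wpM2l h1' e2.
apply: (le_trans (lerD e1' e2')).
have -> : p * (1 + y * (1 - p) + 2 * (y * (1 - p)) ^+ 2) +
  (1 - p) * (1 - y * p + 2 * (y * p) ^+ 2) = 1 + 2 * y ^+ 2 * (p * (1-p)) by ring.
(* p (1 - p) is at most 1 = p (1 - p) + (p^2 + (1 - p)^2 + p (1 - p)). *)
rewrite lerD2l lerDl.
by apply: mulr_ge0; [exact: mulr_ge0|rewrite !addr_ge0 // mulr_ge0].
Qed.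

Definition set_coord g i b : {ffun I -> bool} := [ffun j => if j == i then b else g j].

(** Conditioning on the coordinate i: pairing each g with g i = true with the
    outcome where that coordinate is flipped. *)
Lemma bern_E_set_coord p f i : 
  bern_E p f = p * bern_E p (fun g => f (set_coord g i true)) +
               (1 - p) * bern_E p (fun g => f (set_coord g i false)).
Proof.
have updK b c g : set_coord (set_coord g i b) i c = set_coord g i c.
  by apply/ffunP => j; rewrite !ffunE; case: eqP.
have upd_id g : set_coord g i (g i) = g.
  by apply/ffunP => j; rewrite !ffunE; case: eqP => [->|].
pose w' g := \prod_(j | j != i) (if g j then p else 1 - p).
have wE g : bern_wt p g = (if g i then p else 1 - p) * w' g.
  by rewrite /bern_wt (bigD1 i).
have w'set_coord g b : w' (set_coord g i b) = w' g.
  by apply: eq_bigr => j /negbTE hj; rewrite ffunE hj.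
have split_sum (F : {ffun I -> bool} -> R) :
    \sum_g F g = \sum_(g : {ffun I -> bool} | g i) (F g + F (set_coord g i false)).
  rewrite (bigID (fun g : {ffun I -> bool} => g i)) /= big_split /=; congr (_ + _).
  rewrite (reindex_onto (fun g => set_coord g i false) (fun g => set_coord g i true)) /=; last first.
    move=> g /negbTE hg; rewrite updK -[RHS]upd_id hg //.
  apply: eq_bigl => g; rewrite ffunE eqxx /= updK.
  apply/eqP/idP => [<-|hg]; first by rewrite ffunE eqxx.
  by rewrite -[RHS]upd_id hg.
rewrite /bern_E !split_sum /= !mulr_sumr -big_split /=.
apply: eq_bigr => g hg; rewrite !wE !w'set_coord hg !updK !ffunE eqxx.
have -> : set_coord g i true = g by rewrite -{2}[g]upd_id hg.
ring.
Qed.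

End Bernoulli.

(** * Binomial variables *)

Section Binomial.
Context (R : realType) (p : R).
Hypothesis (p_ge0 : 0 <= p) (p_le1 : p <= 1).

(** Defined by conditioning on one trial at a time, so that linearity, Fubini and
    the second moment are inductions on n. *)
Fixpoint binomE n (f : nat -> R) : R :=
  if n is m.+1 then p * binomE m (fun k => f k.+1) + (1 - p) * binomE m f else f 0%N.

Lemma eq_binomE n f1 f2 : f1 =1 f2 -> binomE n f1 = binomE n f2.
Proof. by move=> h; congr binomE; apply: funext. Qed.

Lemma binomED n f1 f2 : binomE n (fun k => f1 k + f2 k) = binomE n f1 + binomE n f2.
Proof. by elim: n f1 f2 => [|n IH] f1 f2 //=; rewrite !IH; ring. Qed.

Lemma binomEZ n c f : binomE n (fun k => c * f k) = c * binomE n f.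
Proof. by elim: n f => [|n IH] f //=; rewrite !IH; ring. Qed.

Lemma binomEZr n c f : binomE n (fun k => f k * c) = binomE n f * c.
Proof. by rewrite mulrC -binomEZ; apply: eq_binomE => k; rewrite mulrC. Qed.

Lemma binomE_cst n c : binomE n (fun=> c) = c.
Proof. by elim: n => [|n IH] //=; rewrite !IH; ring. Qed.

Lemma binomE_sum n (J : Type) (r : seq J) (F : J -> nat -> R) :
  binomE n (fun k => \sum_(j <- r) F j k) = \sum_(j <- r) binomE n (F j).
Proof.
elim: r => [|j r IH].
  by rewrite big_nil -[RHS](binomE_cst n); apply: eq_binomE => k; rewrite big_nil.
by rewrite big_cons -IH -binomED; apply: eq_binomE => k; rewrite big_cons.
Qed.

Lemma ler_binomE n f1 f2 : (forall k, f1 k <= f2 k) -> binomE n f1 <= binomE n f2.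
Proof.
have q0 : 0 <= 1 - p by rewrite subr_ge0.
by elim: n f1 f2 => [|n IH] f1 f2 h //=; apply: lerD; apply: ler_wpM2l => //; apply: IH.
Qed.

Lemma exchange_binomE m n (F : nat -> nat -> R) :
  binomE m (fun k => binomE n (F k)) = binomE n (fun l => binomE m (F^~ l)).
Proof.
elim: m F => [|m IH] F //=.
by rewrite (IH (fun k => F k.+1)) IH -!binomEZ -binomED.
Qed.

Lemma binomE_addn m n f : binomE (m + n) f = binomE m (fun k => binomE n (fun l => f (k + l)%N)).
Proof.
elim: m f => [|m IH] f //=.
by rewrite !IH; congr (_ * _ + _); do 2!apply: eq_binomE => ?; rewrite addSn.
Qed.

Lemma binomE_sqr n c :
  binomE n (fun k => (k%:R + c) ^+ 2) = (p * n%:R + c) ^+ 2 + n%:R * (p * (1 - p)).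
Proof.
elim: n c => [|n IH] c /=; first by rewrite mulr0 mul0r addr0.
rewrite (@eq_binomE _ _ (fun k => (k%:R + (c + 1)) ^+ 2)); last first.
  by move=> k; rewrite -natr1; congr (_ ^+ 2); ring.
by rewrite !IH -natr1; ring.
Qed.

Lemma binomE_chebyshev n t : 0 < t ->
  binomE n (fun k => (t <= `|k%:R - p * n%:R|)%R%:R) <= n%:R / (4 * t ^+ 2).
Proof.
move=> t0.
have t2 : 0 < t ^+ 2 by apply: exprn_gt0.
have hq : p * (1 - p) <= 4^-1.
  have := sqr_ge0 (p - 2^-1); rewrite expr2; lra.
apply: (@le_trans _ _ (binomE n (fun k => (t ^+ 2)^-1 * (k%:R + - (p * n%:R)) ^+ 2))).
  apply: ler_binomE => k; case: (lerP t) => h /=; last first.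
    by rewrite mulr0n mulr_ge0 ?invr_ge0 ?sqr_ge0 // ltW.
  rewrite mulr1n ler_pdivlMl // mulr1 -(real_normK (num_real (_ + _))).
  by rewrite lerXn2r ?nnegrE // ltW.
rewrite binomEZ binomE_sqr subrr expr0n /= add0r [(4 * _)^-1]invfM [leLHS]mulrC -[leLHS]mulrA.
apply: ler_wpM2l => //; apply: ler_wpM2r => //.
by rewrite invr_ge0 ltW.
Qed.

(** Two independent copies of a variable that lies with probability 3/4 in an
    interval of length 2 s, cut into M cells of length w, fall in the same cell
    with probability at least the sum of the squares of the cell probabilities,
    which Cauchy-Schwarz bounds below. *)
Lemma binomE_collision n (s w : R) M : 0 < s -> n%:R <= s ^+ 2 -> 0 < w ->
  2 * s < M%:R * w ->
  9 / 16 / M%:R <= binomE n (fun k => binomE n (fun l => (`|k%:R - l%:R| < w)%R%:R)).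
Proof.
move=> s0 ns w0 hM.
have M0 : 0 < M%:R :> R.
  by rewrite -(pmulr_lgt0 _ w0); apply: lt_trans hM; rewrite mulr_gt0.
(* On the event of probability 3/4, x k lies in [0, 2 s]; chi m is the cell number m. *)
pose x (k : nat) : R := k%:R - p * n%:R + s.
pose chi (m k : nat) : R := ((m%:R * w <= x k) && (x k < m.+1%:R * w))%:R.
have chiE k : \sum_(0 <= m < M) chi m k = ((0 <= x k) && (x k < M%:R * w))%:R.
  elim: (M) => [|j IH].
    by rewrite big_geq // mul0r; case: (lerP 0 (x k)).
  rewrite big_nat_recr //= IH /chi -[j.+1%:R]natr1 mulrDl mul1r.
  have hj : 0 <= j%:R * w by rewrite mulr_ge0 // ltW.
  case: (lerP 0 (x k)) => h1; case: (lerP (j%:R * w) (x k)) => h2;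
    case: (ltrP (x k) (j%:R * w + w)) => h3 /=;
    rewrite ?addr0 ?add0r //; exfalso; lra.
pose P m := binomE n (chi m).
have lowP : 3 / 4 <= \sum_(0 <= m < M) P m.
  rewrite -binomE_sum.
  have h1 := binomE_chebyshev n s0.
  have h2 : 1 - (fun k => (s <= `|k%:R - p * n%:R|)%R%:R) 0%N <= 1 :> R.
    by rewrite lerBlDr lerDl ler0n.
  apply: (@le_trans _ _ (binomE n (fun k => 1 + -1 * (s <= `|k%:R - p * n%:R|)%R%:R))).
    rewrite binomED binomE_cst binomEZ.
    have : n%:R / (4 * s ^+ 2) <= 4^-1.
      rewrite ler_pdivrMr ?mulr_gt0 ?exprn_gt0 //; lra.
    lra.
  apply: ler_binomE => k; rewrite chiE.
  case: (lerP s) => h; first by rewrite mulr1n mulr1 subrr ler0n.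
  rewrite mulr0n mulr0 addr0.
  move: h; rewrite ltr_norml => /andP[h3 h4].
  have -> : 0 <= x k by rewrite /x; lra.
  have -> // : x k < M%:R * w by apply: lt_trans hM; rewrite /x; lra.
(* Cauchy-Schwarz, as the nonnegativity of a variance. *)
have cs : (\sum_(0 <= m < M) P m) ^+ 2 <= M%:R * \sum_(0 <= m < M) P m ^+ 2.
  pose S := \sum_(0 <= m < M) P m.
  have : 0 <= \sum_(0 <= m < M) (M%:R * P m - S) ^+ 2.
    by apply: sumr_ge0 => m _; exact: sqr_ge0.
  have -> : \sum_(0 <= m < M) (M%:R * P m - S) ^+ 2 =
     M%:R * (M%:R * (\sum_(0 <= m < M) P m ^+ 2) - S ^+ 2).
    transitivity (\sum_(0 <= m < M) (M%:R ^+ 2 * P m ^+ 2 + (- 2 * M%:R * S) * P m + S ^+ 2)).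
      by apply: eq_bigr => m _; ring.
    rewrite !big_split /= -!mulr_sumr -/S sumr_const_nat subn0 -[S *+ M]mulr_natl.
    ring.
  by rewrite pmulr_rge0 // subr_ge0.
apply: (@le_trans _ _ (\sum_(0 <= m < M) P m ^+ 2)).
  rewrite ler_pdivrMr // [leRHS]mulrC; apply: le_trans cs.
  have := lowP; set S := \sum_(_ <= _ < _) _ => hS; rewrite expr2; nra.
have -> : \sum_(0 <= m < M) P m ^+ 2 =
    binomE n (fun k => binomE n (fun l => \sum_(0 <= m < M) chi m k * chi m l)).
  transitivity (\sum_(0 <= m < M) binomE n (fun k => binomE n (fun l => chi m k * chi m l))).
    by apply: eq_bigr => m _; under eq_binomE => k do rewrite binomEZ; rewrite binomEZr expr2.
  by rewrite -binomE_sum; apply: eq_binomE => k; rewrite -binomE_sum.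
apply: ler_binomE => k; apply: ler_binomE => l.
apply: (@le_trans _ _ (\sum_(0 <= m < M) chi m k * (`|k%:R - l%:R| < w)%R%:R)).
  apply: ler_sum => m _; rewrite /chi -[m.+1%:R]natr1 mulrDl mul1r.
  case: (boolP (_ && _)) => [/andP[h1 h2]|_]; last by rewrite !mul0r.
  rewrite !mul1r; case: (boolP (_ && _)) => [/andP[h3 h4]|_]; last by rewrite ler0n.
  have -> // : `|k%:R - l%:R| < w :> R.
  rewrite ltr_norml; move: h1 h2 h3 h4; rewrite /x => *; apply/andP; split; lra.
rewrite -mulr_suml chiE; case: (_ < w)%R; rewrite ?mulr0 // mulr1 ler_nat.
by case: (_ && _).
Qed.

(** A binomial of a trials minus an independent binomial of b <= a trials falls
    below tau with probability bounded away from 1/2.  Match b of the a trials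
    with the b others: the matched difference is symmetric and within y of 0 with
    probability bounded below, and by Chebyshev the a - b remaining trials
    contribute more than tau + y. *)
Lemma binomE_biased a b (tau y s : R) M : (b <= a)%N -> 0 < s -> b%:R <= s ^+ 2 ->
  0 < y -> 2 * s < M%:R * y -> tau + y < p * (a - b)%:R ->
  binomE a (fun k => binomE b (fun l => (k%:R - l%:R <= tau)%R%:R)) <=
  2^-1 - 9 / 32 / M%:R + (a - b)%:R / (4 * (p * (a - b)%:R - (tau + y)) ^+ 2).
Proof.
move=> ba s0 bs y0 hM htau.
set m := (a - b)%N in htau *.
have -> : a = (m + b)%N by rewrite subnK.
rewrite binomE_addn.
have sym : binomE b (fun k => binomE b (fun l => (k%:R - l%:R <= - y)%R%:R)) <=
   2^-1 - 9 / 32 / M%:R.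
  have h1 := @binomE_collision b s y M s0 bs y0 hM.
  set Q := binomE b _.
  have Q' : Q = binomE b (fun k => binomE b (fun l => (l%:R - k%:R <= - y)%R%:R)).
    by rewrite /Q exchange_binomE.
  have h2 : Q + Q + binomE b (fun k => binomE b (fun l => (`|k%:R - l%:R| < y)%R%:R)) <= 1.
    rewrite {2}Q' /Q -!binomED -[leRHS](binomE_cst b) ; apply: ler_binomE => k.
    rewrite -!binomED -[leRHS](binomE_cst b); apply: ler_binomE => l.
    rewrite ltr_norml.
    case: (lerP (k%:R - l%:R) (- y)) => h3; case: (lerP (l%:R - k%:R) (- y)) => h4;
      case: (ltrP (k%:R - l%:R) y) => h5;
      rewrite /= ?mulr0n ?mulr1n; lra.
  have : 9 / 16 / M%:R = 2 * (9 / 32 / M%:R) :> R.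
    rewrite [RHS]mulrA; congr (_ / _); lra.
  lra.
have cheb : binomE m (fun j => (j%:R < tau + y)%R%:R) <=
    m%:R / (4 * (p * m%:R - (tau + y)) ^+ 2).
  have t0 : 0 < p * m%:R - (tau + y) by rewrite subr_gt0.
  apply: le_trans (binomE_chebyshev m t0).
  apply: ler_binomE => j; case: (ltrP (j%:R)) => h; last by rewrite ler0n.
  have -> // : p * m%:R - (tau + y) <= `|j%:R - p * m%:R|.
  by rewrite distrC; apply: le_trans (ler_norm _); lra.
apply: le_trans (lerD sym cheb).
rewrite exchange_binomE.
rewrite -[X in _ <= X + _](binomE_cst m) -binomED -[leLHS]exchange_binomE.
apply: ler_binomE => j.
rewrite -[X in _ <= _ + X](binomE_cst b) -binomED.
apply: ler_binomE => k.
rewrite -[X in _ <= _ + X](binomE_cst b) -binomED.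
apply: ler_binomE => l.
rewrite natrD.
case: (lerP (j%:R + k%:R - l%:R) tau) => h1; last by rewrite addr_ge0 ?ler0n.
case: (lerP (k%:R - l%:R) (- y)) => h2; first by rewrite lerDl ler0n.
case: (ltrP j%:R (tau + y)) => h3; first by rewrite lerDr ler0n.
exfalso; lra.
Qed.

End Binomial.

(** * Counting successes in disjoint sets of coordinates *)

Section Counts.
Context (R : realType) (p : R) (I : finType).
Implicit Types (J : {set I}).

Definition insensitive (K : Type) (h : {ffun I -> bool} -> K) J :=
  forall i, i \in J -> forall g b, h (set_coord g i b) = h g.

Definition count_in J (g : {ffun I -> bool}) : nat := \sum_(i in J) g i.

Lemma count_in_insensitive J1 J2 : [disjoint J1 & J2] -> insensitive (count_in J1) J2.
Proof.
move=> dis i iJ g b; apply: eq_bigr => j jJ; rewrite ffunE.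
by case: eqP jJ => // ->; rewrite (disjointFl dis iJ).
Qed.

(** The number of successes in J is binomial and independent of everything that
    the coordinates in J do not influence; condition on the elements of J one by
    one. *)
Lemma bern_E_count (K : Type) J (h : {ffun I -> bool} -> K) (F : nat -> K -> R) :
  insensitive h J ->
  bern_E p (fun g => F (count_in J g) (h g)) =
  binomE p #|J| (fun k => bern_E p (fun g => F k (h g))).
Proof.
move En : #|J| => n.
elim: n J F En => [|n IH] J F En hJ.
  move/eqP: En; rewrite cards_eq0 => /eqP ->.
  by congr bern_E; apply: funext => g; rewrite /count_in big_set0.
have [i iJ] : exists i, i \in J by apply/set0Pn; rewrite -cards_eq0 En.
have cJ : #|J :\ i| = n by have := cardsD1 i J; rewrite iJ En => -[].
have cntE g b : count_in J (set_coord g i b) = (b + count_in (J :\ i) g)%N.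
  rewrite /count_in (big_setD1 i iJ) ffunE eqxx; congr addn.
  apply: eq_bigr => j; rewrite !inE ffunE => /andP[/negbTE -> _] //.
have hJ' : insensitive h (J :\ i).
  by move=> j; rewrite !inE => /andP[_ jJ]; apply: hJ.
rewrite (bern_E_set_coord p _ i) /=.
under [X in bern_E p X]funext do rewrite cntE hJ //.
under [X in _ + _ * bern_E p X]funext do rewrite cntE hJ //.
by rewrite (IH _ (fun k => F k.+1)) // (IH _ F).
Qed.

Lemma bern_E_count2 J1 J2 (F : nat -> nat -> R) : [disjoint J1 & J2] ->
  bern_E p (fun g => F (count_in J1 g) (count_in J2 g)) =
  binomE p #|J1| (fun k => binomE p #|J2| (F k)).
Proof.
move=> dis.
rewrite (bern_E_count F (h := count_in J2)); last first.
  by apply: count_in_insensitive; rewrite disjoint_sym.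
apply: eq_binomE => k.
rewrite (bern_E_count (fun l (_ : unit) => F k l) (h := fun=> tt)) //.
by apply: eq_binomE => l; rewrite bern_E_cst.
Qed.

(** Stated for functions of two counts, which is the form of an excess of
    neighbours. *)
Lemma bern_E_indep J1 J2 (F : nat -> nat -> R) (H : {ffun I -> bool} -> R) :
  [disjoint J1 & J2] -> insensitive H (J1 :|: J2) ->
  bern_E p (fun g => F (count_in J1 g) (count_in J2 g) * H g) =
  bern_E p (fun g => F (count_in J1 g) (count_in J2 g)) * bern_E p H.
Proof.
move=> dis hH; rewrite bern_E_count2 //.
rewrite (bern_E_count (fun k (z : nat * R) => F k z.1 * z.2)
   (h := fun g => (count_in J2 g, H g))); last first.
  move=> i iJ g b; rewrite hH ?inE ?iJ //; congr (_, _).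
  by rewrite disjoint_sym in dis; apply: count_in_insensitive dis _ _ _ _.
rewrite -binomEZr; apply: eq_binomE => k /=.
rewrite (bern_E_count (fun l (z : R) => F k l * z)); last first.
  by move=> i iJ g b; rewrite hH // !inE iJ orbT.
by rewrite -binomEZr; apply: eq_binomE => l; rewrite bern_EZ.
Qed.

End Counts.

(** * Graphs given by their edge indicators *)

Section EdgeGraph.
Context (N : nat).
Implicit Types (g : {ffun vpair N -> bool}) (S K : {set 'I_N}) (u w : 'I_N).

Definition edge_adj g : rel 'I_N :=
  fun u w => oapp g false (insub (u, w)) || oapp g false (insub (w, u)).

Lemma edge_adj_sym g : symmetric (edge_adj g).
Proof. by move=> u w; rewrite /edge_adj orbC. Qed.

Lemma edge_adj_irrefl g : irreflexive (edge_adj g).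
Proof. by move=> u; rewrite /edge_adj insubF //= ltnn. Qed.

Definition graph_of g := SGraph (edge_adj_sym g) (edge_adj_irrefl g).

Lemma graph_of_vpair g (e : vpair N) : graph_of g (val e).1 (val e).2 = g e.
Proof.
rewrite /= /edge_adj -surjective_pairing valK /= insubF /= ?orbF //.
by apply/negbTE; rewrite -leqNgt ltnW // (valP e).
Qed.

Lemma sum_vpair (V : nmodType) (F : 'I_N * 'I_N -> V) :
  \sum_(x : 'I_N * 'I_N | (x.1 < x.2)%N) F x = \sum_(e : vpair N) F (val e).
Proof.
have [e0|/pred0P h] := pickP (xpredT : pred (vpair N)) .
  move=> _; rewrite (reindex_onto (val : vpair N -> _) (insubd e0)) /=; last first.
    by move=> x hx; rewrite insubdK.
  by apply: eq_bigl => e; rewrite (valP e) valKd eqxx.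
rewrite [RHS]big1; last by move=> e _; have := h; move/pred0P/(_ e).
rewrite big1 // => x hx.
by move/pred0P/(_ (Sub x hx : vpair N)): h.
Qed.

(** Double counting: each edge is met from both of its ends. *)
Lemma sum_graph_of (V : nmodType) g (f : 'I_N -> 'I_N -> V) :
  \sum_u \sum_w f u w *+ graph_of g u w =
  \sum_(e : vpair N) (f (val e).1 (val e).2 + f (val e).2 (val e).1) *+ g e.
Proof.
rewrite pair_bigA /=.
rewrite (bigID (fun x : 'I_N * 'I_N => (x.1 < x.2)%N)) /=.
rewrite (bigID (fun x : 'I_N * 'I_N => (x.2 < x.1)%N) (fun x => ~~ _)) /=.
rewrite [X in _ + (_ + X)]big1 ?addr0; last first.
  move=> [u w] /=; rewrite -!leqNgt => /anti_leq /val_inj ->.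
  by rewrite edge_adj_irrefl.
rewrite [X in _ + X](_ : _ = \sum_(x : 'I_N * 'I_N | (x.1 < x.2)%N)
     f x.2 x.1 *+ edge_adj g x.2 x.1); last first.
  rewrite [RHS](reindex_inj (h := fun x : 'I_N * 'I_N => (x.2, x.1))) /=; last first.
    by move=> [? ?] [? ?] /= [-> ->].
  by apply: eq_bigl => -[u w] /=; case: ltngtP.
rewrite sum_vpair (sum_vpair (fun x => f x.2 x.1 *+ edge_adj g x.2 x.1)).
rewrite -big_split; apply: eq_bigr => e _ /=.
by rewrite [edge_adj g _ _ in X in _ + X]edge_adj_sym
  -[edge_adj g _ _]/(graph_of g _ _) graph_of_vpair mulrnDl.
Qed.

(** The complete graph serves to count pairs of distinct vertices: an identity for
    the edges of a graph gives the corresponding one for pairs. *)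
Definition all_edges : {ffun vpair N -> bool} := [ffun=> true].

Lemma graph_of_complete u w : graph_of all_edges u w = (u != w).
Proof.
rewrite /= /edge_adj; case: (ltngtP u w) => h.
- by rewrite insubT /= ffunE; apply/esym/eqP => E; rewrite E ltnn in h.
- by rewrite orbC insubT /= ffunE; apply/esym/eqP => E; rewrite E ltnn in h.
- by rewrite !insubF /= ?h ?ltnn // (val_inj h) eqxx.
Qed.

Definition deg_in (G : sgraph N) S u : nat := \sum_(w in S) G u w.

Definition star u S : {set vpair N} := [set e : vpair N |
  ((val e).1 == u) && ((val e).2 \in S) || ((val e).2 == u) && ((val e).1 \in S)].

Lemma deg_in_star g S u : deg_in (graph_of g) S u = count_in (star u S) g.
Proof.
pose f (u' w : 'I_N) : nat := ((u' == u) && (w \in S)).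
have := @sum_graph_of nat g f.
rewrite (bigD1 u) //= [X in _ + X]big1; last first.
  move=> u' /negbTE hu; apply: big1 => w _; rewrite /f hu /=.
  by rewrite mul0rn.
rewrite addr0 => h.
have e1 : \sum_(w : 'I_N) f u w *+ edge_adj g u w = deg_in (graph_of g) S u.
  rewrite /deg_in [RHS]big_mkcond; apply: eq_bigr => w _.
  rewrite /f eqxx /=; case: (w \in S); case: (edge_adj g u w) => //.
rewrite -e1 h /count_in [RHS]big_mkcond; apply: eq_bigr => e _.
rewrite !inE /f; case: (g e) => /=; last by rewrite mulr0n; case: ifP.
rewrite mulr1n.
move: (valP e) => /=; move: (sval e) => [a b] /= ab.
have : ~~ ((a == u) && (b == u)).
  by apply/negP => /andP[/eqP E1 /eqP E2]; rewrite E1 E2 ltnn in ab.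
by case: (a == u); case: (b == u); case: (a \in S); case: (b \in S).
Qed.

Lemma card_star u S : #|star u S| = #|S :\ u|.
Proof.
have := deg_in_star all_edges S u.
have -> : count_in (star u S) all_edges = #|star u S|.
  by rewrite /count_in -sum1_card; apply: eq_bigr => e _; rewrite ffunE.
move=> <-; rewrite /deg_in -sum1_card.
rewrite [LHS]big_mkcond [RHS]big_mkcond; apply: eq_bigr => w _.
rewrite graph_of_complete !inE eq_sym.
by case: (w == u); case: (w \in S).
Qed.

End EdgeGraph.

(** * Edge counts and degrees of a random graph *)

Lemma negb_forall_le_sum (R : realType) (I : finType) (b : pred I) :
  (~~ [forall x, b x])%:R <= \sum_x (~~ b x)%:R :> R.
Proof.
case: (boolP [forall x, b x]) => [_|]; first exact: sumr_ge0.
rewrite negb_forall => /existsP[x bx].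
by rewrite (bigD1 x) //= bx lerDl sumr_ge0.
Qed.

Lemma expR1_ge2 (R : realType) : 2 <= expR 1 :> R.
Proof. by have := expR_ge1Dx (1 : R). Qed.

Section Jumbled.
Context (R : realType) (p : R) (N : nat).
Hypothesis (p_ge0 : 0 <= p) (p_le1 : p <= 1).
Implicit Types (g : {ffun vpair N -> bool}) (S K : {set 'I_N}) (G : sgraph N).

Definition edges_between G K S : R := \sum_(u in K) (deg_in G S u)%:R.

(** Edges inside K :&: S are counted twice, and pairs (u, u) never; comparing
    with the complete graph makes the deviation exactly centred. *)
Definition deviation G K S : R :=
  edges_between G K S - p * edges_between (graph_of (all_edges N)) K S.

(** Chernoff's bound with a fixed lam, for the deviation at which the union bound
    over the 4^N pairs (K, S) still succeeds.  A lam of order 1/s bounds the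
    deviation of all pairs by order N s; a constant lam is better when one of the
    sets has only order s elements. *)
Definition jumbled lam G : bool :=
  [forall K : {set 'I_N}, [forall S : {set 'I_N},
    `|deviation G K S| <= 4 * lam * (#|K|%:R * #|S|%:R) + 3 * N%:R / lam]].

Definition edge_mult K S (e : vpair N) : R :=
  (((val e).1 \in K) && ((val e).2 \in S))%:R +
  (((val e).2 \in K) && ((val e).1 \in S))%:R.

Lemma edges_between_edge_mult g K S :
  edges_between (graph_of g) K S = \sum_e edge_mult K S e * (g e)%:R.
Proof.
transitivity (\sum_u \sum_w ((u \in K) && (w \in S))%:R *+ graph_of g u w : R).
  rewrite /edges_between big_mkcond; apply: eq_bigr => u _.
  case: (u \in K); last by rewrite big1 // => w _; rewrite mul0rn.
  rewrite /deg_in natr_sum big_mkcond; apply: eq_bigr => w _ /=.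
  by case: (w \in S); rewrite ?mul0rn.
rewrite sum_graph_of; apply: eq_bigr => e _.
by rewrite mulr_natr.
Qed.

Lemma edge_mult_ge0 K S e : 0 <= edge_mult K S e.
Proof. by rewrite addr_ge0. Qed.

Lemma edge_mult_le2 K S e : edge_mult K S e <= 2.
Proof. by rewrite /edge_mult; do 2!case: (_ && _); rewrite /= ?mulr0n ?mulr1n; lra. Qed.

Lemma sum_edge_mult K S : \sum_e edge_mult K S e = edges_between (graph_of (all_edges N)) K S.
Proof. by rewrite edges_between_edge_mult; apply: eq_bigr => e _; rewrite ffunE mulr1. Qed.

Lemma deviation_edge_mult g K S :
  deviation (graph_of g) K S = \sum_e edge_mult K S e * ((g e)%:R - p).
Proof.
rewrite /deviation -sum_edge_mult edges_between_edge_mult mulr_sumr -sumrB.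
by apply: eq_bigr => e _; ring.
Qed.

Lemma deg_in_complete S u : deg_in (graph_of (all_edges N)) S u = #|S :\ u|.
Proof.
rewrite deg_in_star -card_star /count_in -sum1_card.
by apply: eq_bigr => e _; rewrite ffunE.
Qed.

Lemma edges_between_complete_le K S :
  edges_between (graph_of (all_edges N)) K S <= #|K|%:R * #|S|%:R.
Proof.
rewrite -natrM -sum_nat_const natr_sum; apply: ler_sum => u _.
by rewrite deg_in_complete ler_nat subset_leq_card // subsetDl.
Qed.

Lemma edges_between_complete_ge K S :
  #|K|%:R * #|S|%:R - #|K|%:R <= edges_between (graph_of (all_edges N)) K S.
Proof.
rewrite -natrM -sum_nat_const lerBlDr -[#|K|]sum1_card !natr_sum -big_split /=.
apply: ler_sum => u _; rewrite deg_in_complete -natrD ler_nat (cardsD1 u S).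
by rewrite addnC leq_add2l; case: (_ \in _).
Qed.

Lemma sum_edge_mult_sqr K S : \sum_e edge_mult K S e ^+ 2 <= 2 * (#|K|%:R * #|S|%:R).
Proof.
apply: (@le_trans _ _ (\sum_e 2 * edge_mult K S e)).
  apply: ler_sum => e _; rewrite expr2; apply: ler_wpM2r; [exact: edge_mult_ge0|exact: edge_mult_le2].
by rewrite -mulr_sumr ler_wpM2l // sum_edge_mult edges_between_complete_le.
Qed.

(** sg is 1 for the upper tail and -1 for the lower tail. *)
Lemma bern_E_deviation lam (sg : R) K S : 0 < lam -> lam <= 4^-1 ->
  `|sg| = 1 ->
  bern_E p (fun g =>
    (4 * lam * (#|K|%:R * #|S|%:R) + 3 * N%:R / lam <= sg * deviation (graph_of g) K S)%R%:R)
  <= expR (- (3 * N%:R)).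
Proof.
move=> l0 l1 sg1.
set t := (X in bern_E _ (fun g => (X <= _)%R%:R)).
have -> : (fun g => (t <= sg * deviation (graph_of g) K S)%R%:R) =
   (fun g => (t <= \sum_e (sg * edge_mult K S e) * ((g e)%:R - p))%R%:R) :> (_ -> R).
  by apply: funext => g; rewrite deviation_edge_mult mulr_sumr;
     under eq_bigr do rewrite mulrA.
apply: (le_trans (bern_chernoff t p_ge0 p_le1 (ltW l0) _)).
  move=> e; rewrite normrM sg1 mul1r ger0_norm ?edge_mult_ge0 //.
  have h1 := edge_mult_le2 K S e; have h2 := edge_mult_ge0 K S e; nra.
rewrite ler_expR.
have -> : \sum_i (sg * edge_mult K S i) ^+ 2 = \sum_i edge_mult K S i ^+ 2.
  apply: eq_bigr => e _; rewrite exprMn -[sg ^+ 2](real_normK (num_real _)) sg1.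
  by rewrite expr1n mul1r.
have h := sum_edge_mult_sqr K S.
have h2 : lam * t = 4 * lam ^+ 2 * (#|K|%:R * #|S|%:R) + 3 * N%:R.
  by rewrite /t; field; lra.
rewrite h2; have := ler_wpM2l (sqr_ge0 lam) h.
lra.
Qed.

Lemma bern_E_not_jumbled lam : 0 < lam -> lam <= 4^-1 ->
  bern_E p (fun g => (~~ jumbled lam (graph_of g))%:R) <= 2 * expR (- N%:R).
Proof.
move=> l0 l1.
pose t K S : R := 4 * lam * (#|K|%:R * #|S|%:R) + 3 * N%:R / lam.
apply: (@le_trans _ _ (bern_E p (fun g => \sum_(K : {set 'I_N}) \sum_(S : {set 'I_N})
   ((t K S <= 1 * deviation (graph_of g) K S)%R%:R +
    (t K S <= -1 * deviation (graph_of g) K S)%R%:R)))).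
  apply: ler_bern_E => // g.
  apply: (le_trans (negb_forall_le_sum _ _)); apply: ler_sum => K _.
  apply: (le_trans (negb_forall_le_sum _ _)); apply: ler_sum => S _.
  rewrite -/(t K S) -ltNge.
  case: (ltrP (t K S)) => h; last by rewrite addr_ge0.
  rewrite mul1r mulN1r; move: h; case: (lerP 0 (deviation (graph_of g) K S)) => hd.
    by rewrite ger0_norm // => h; rewrite (ltW h) lerDl.
  by rewrite ltr0_norm // => h; rewrite (ltW h) lerDr.
rewrite bern_E_sum.
apply: (@le_trans _ _ (\sum_(K : {set 'I_N}) \sum_(S : {set 'I_N}) (2 * expR (- (3 * N%:R))))).
  apply: ler_sum => K _; rewrite bern_E_sum; apply: ler_sum => S _.
  rewrite bern_ED -[2]/(1 + 1) mulrDl !mul1r; apply: lerD; apply: bern_E_deviation => //.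
    exact: normr1.
  by rewrite normrN1.
rewrite !sumr_const -!mulrnA.
have -> : #|{: {set 'I_N}}| = (2 ^ N)%N.
  by rewrite -cardsT -powersetT card_powerset cardsT card_ord.
rewrite -[leLHS]mulr_natr natrM natrX -mulrA ler_pM2l //.
have h2 : 2 ^+ N <= expR N%:R :> R.
  rewrite -[N%:R]mulr1 expRM_natl lerXn2r ?nnegrE ?expR_ge0 //.
  exact: expR1_ge2.
have h3 : 0 <= 2 ^+ N :> R by apply: exprn_ge0.
have -> : - N%:R = - (3 * N%:R) + (N%:R + N%:R) :> R by ring.
rewrite !expRD ler_wpM2l ?expR_ge0 //.
by apply: ler_pM.
Qed.

Definition min_degree_ok G : bool :=
  [forall u, p * N.-1%:R - p * N%:R / 4 < (deg_in G finset.setT u)%:R].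

Lemma bern_E_not_min_degree_ok : 0 < p ->
  bern_E p (fun g => (~~ min_degree_ok (graph_of g))%:R) <=
  N%:R * expR (- (p ^+ 2 / 128 * N%:R)).
Proof.
move=> p0.
apply: (@le_trans _ _ (bern_E p (fun g => \sum_(u : 'I_N)
   ((deg_in (graph_of g) finset.setT u)%:R <= p * N.-1%:R - p * N%:R / 4)%R%:R))).
  apply: ler_bern_E => // g; apply: (le_trans (negb_forall_le_sum _ _)).
  by apply: ler_sum => u _; rewrite -leNgt.
rewrite bern_E_sum mulr_natl.
have -> : expR (- (p ^+ 2 / 128 * N%:R)) *+ N =
   \sum_(u < N) expR (- (p ^+ 2 / 128 * N%:R)) by rewrite sumr_const card_ord.
apply: ler_sum => u _.
pose a (e : vpair N) : R := - (e \in star u finset.setT)%:R.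
have cardT : #|star u finset.setT| = N.-1.
  by have := cardsD1 u finset.setT; rewrite card_star inE cardsT card_ord => /(congr1 predn).
have sumT (b : vpair N -> R) : \sum_e (e \in star u finset.setT)%:R * b e =
    \sum_(e in star u finset.setT) b e.
  rewrite [RHS]big_mkcond; apply: eq_bigr => e _.
  by case: (_ \in _); rewrite ?mul1r ?mul0r.
have -> : (fun g => ((deg_in (graph_of g) finset.setT u)%:R <=
     p * N.-1%:R - p * N%:R / 4)%R%:R) =
   (fun g => (p * N%:R / 4 <= \sum_e a e * ((g e)%:R - p))%R%:R) :> (_ -> R).
  apply: funext => g; congr (_%:R); congr nat_of_bool.
  under eq_bigr => e _ do rewrite /a mulNr.
  rewrite sumrN sumT sumrB sumr_const cardT deg_in_star /count_in natr_sum.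
  rewrite -[p *+ _]mulr_natr.
  by apply/idP/idP; lra.
have l0 : 0 <= p / 16 by lra.
apply: (le_trans (bern_chernoff _ p_ge0 p_le1 l0 _)).
  move=> e; rewrite normrN /a; case: (_ \in _); last first.
    by rewrite normr0 mulr0 invr_ge0.
  rewrite mulr1n normr1 mulr1; move: (p_le1) => ?; lra.
rewrite ler_expR.
have -> : \sum_i a i ^+ 2 = N.-1%:R.
  rewrite -cardT -sum1_card natr_sum -sumT; apply: eq_bigr => e _.
  by rewrite /a sqrrN; case: (_ \in _); rewrite ?expr0n ?expr1n ?mulr1.
have : N.-1%:R <= N%:R :> R by rewrite ler_nat leq_pred.
move=> /(ler_wpM2l (sqr_ge0 p)); rewrite !expr2; lra.
Qed.

End Jumbled.

(** * Concentration of the number of vertices with a small advantage *)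

Section Cutoff.
Context (R : realType) (tau eta : R).
Hypothesis (eta_gt0 : 0 < eta).

(** A Lipschitz majorant of the indicator of x <= tau, so that flipping one edge
    changes it by at most 1 / eta. *)
Definition cutoff (x : R) : R := Num.min 1 (Num.max 0 ((tau + eta - x) / eta)).

Lemma cutoff_ge0 x : 0 <= cutoff x.
Proof. by rewrite /cutoff le_min ler01 le_max lexx. Qed.

Lemma cutoff_le1 x : cutoff x <= 1.
Proof. by rewrite /cutoff ge_min lexx. Qed.

Lemma cutoff_ge_ind x : (x <= tau)%R%:R <= cutoff x.
Proof.
case: (lerP x tau) => h; last exact: cutoff_ge0.
rewrite /cutoff le_min lexx le_max /=; apply/orP; right.
rewrite ler_pdivlMr // mul1r; lra.
Qed.

Lemma cutoff_le_ind x : cutoff x <= (x <= tau + eta)%R%:R.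
Proof.
case: (lerP x (tau + eta)) => h; first exact: cutoff_le1.
rewrite /cutoff ge_min; apply/orP; right.
rewrite ge_max lexx /= ler_pdivrMr // mul0r; lra.
Qed.

Lemma cutoff_lipschitz x y : `|x - y| <= 1 -> cutoff x <= cutoff y + eta^-1.
Proof.
move=> h.
have i0 : 0 < eta^-1 by rewrite invr_gt0.
have hxy : (tau + eta - x) / eta <= (tau + eta - y) / eta + eta^-1.
  rewrite -{3}[eta^-1]mul1r -mulrDl; apply: ler_wpM2r; first exact: ltW.
  move: h; rewrite ler_norml => /andP[]; lra.
rewrite /cutoff; move: hxy; set a := (_ / _); set b := (_ / _) => hab.
rewrite /Num.min /Num.max.
by case: (ltrP 0 a) => h1; case: (ltrP 0 b) => h2; case: ltrP => h3; case: ltrP => h4; lra.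
Qed.

End Cutoff.

Section Population.
Context (R : realType) (p : R) (N : nat).
Hypothesis (p_ge0 : 0 <= p) (p_le1 : p <= 1).
Implicit Types (g : {ffun vpair N -> bool}) (S A : {set 'I_N}) (u : 'I_N).

Definition advantage (G : sgraph N) A u : R :=
  (deg_in G A u)%:R - (deg_in G (~: A) u)%:R.

(** A pair in both stars would be formed by u and u', or would have the same other
    end in S and S'. *)
Lemma disjoint_star u u' S S' : (u = u' -> [disjoint S & S']) ->
  ~~ ((u' \in S) && (u \in S')) -> [disjoint star u S & star u' S'].
Proof.
move=> hd hn; apply/pred0P => e /=; apply/negbTE.
rewrite !inE; apply/negP => /andP[].
case/orP=> /andP[/eqP E1 h1]; case/orP=> /andP[/eqP E2 h2].
- by have := disjointFr (hd (etrans (esym E1) E2)) h1; rewrite h2.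
- by move: hn; rewrite -E1 -E2 h1 h2.
- by move: hn; rewrite -E1 -E2 h1 h2.
- by have := disjointFr (hd (etrans (esym E1) E2)) h1; rewrite h2.
Qed.

Lemma bern_E_advantage A u (F : R -> R) :
  bern_E p (fun g => F (advantage (graph_of g) A u)) =
  binomE p #|A :\ u| (fun k => binomE p #|~: A :\ u| (fun l => F (k%:R - l%:R))).
Proof.
rewrite -!card_star -(bern_E_count2 p (fun k l => F (k%:R - l%:R))).
  by congr bern_E; apply: funext => g; rewrite /advantage !deg_in_star.
apply: disjoint_star => [_|]; first by rewrite finset.disjoints_subset finset.setCK.
by rewrite inE; case: (_ \in _).
Qed.

(** Leaving out the edge towards u' makes this independent of the corresponding
    quantity for u'. *)
Definition advantage_off A u u' g : R :=
  (count_in (star u (A :\ u')) g)%:R - (count_in (star u (~: A :\ u')) g)%:R.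

Lemma advantage_off_close A u u' g :
  `|advantage (graph_of g) A u - advantage_off A u u' g| <= 1.
Proof.
have e S : deg_in (graph_of g) S u =
    ((u' \in S) * graph_of g u u' + count_in (star u (S :\ u')) g)%N.
  rewrite -deg_in_star /deg_in; case: (boolP (u' \in S)) => h.
    by rewrite (big_setD1 _ h) /= mul1n.
  rewrite mul0n add0n; apply: eq_bigl => w; rewrite !inE.
  by case: eqP => // ->; rewrite (negbTE h).
rewrite /advantage /advantage_off !e inE.
case: (u' \in A); case: (graph_of g u u'); 
  rewrite !(mul0n, mul1n, muln0, add0n) ?natrD ?mulr1n ler_norml; apply/andP; split; lra.
Qed.

Lemma advantage_off_indep A u u' (F F' : R -> R) : u != u' ->
  bern_E p (fun g => F (advantage_off A u u' g) * F' (advantage_off A u' u g)) =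
  bern_E p (fun g => F (advantage_off A u u' g)) *
  bern_E p (fun g => F' (advantage_off A u' u g)).
Proof.
move=> uu.
rewrite /advantage_off.
rewrite -(bern_E_indep p (J1 := star u (A :\ u')) (J2 := star u (~: A :\ u'))
  (fun k l => F (k%:R - l%:R))) //.
  apply: disjoint_star => [_|]; last by rewrite !inE uu; case: (u \in A).
  rewrite finset.disjoints_subset; by apply/fintype.subsetP => w; rewrite !inE => /andP[-> ->].
have dis S S' : [disjoint star u' (S' :\ u) & star u (S :\ u')].
  apply: disjoint_star => [E|]; first by rewrite E eqxx in uu.
  by rewrite !inE eqxx.
move=> e; rewrite inE => he g b; congr (F' (_%:R - _%:R)); case/orP: he => he;
  exact: (count_in_insensitive (dis _ _) he).
Qed.

(** Chebyshev's inequality for the sum over u of the cutoffs of the advantages.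
    For u <> u' their covariance is at most 5 / eta: removing the edge between
    them changes each cutoff by at most 1 / eta and makes them independent. *)
Lemma population_concentration A (tau eta q c : R) : 1 <= eta -> 0 < c -> (0 < N)%N ->
  (forall u, bern_E p (fun g => (advantage (graph_of g) A u <= tau + eta)%R%:R) <= q) ->
  bern_E p (fun g =>
    ((q + c) * N%:R < #|[set u | (advantage (graph_of g) A u <= tau)%R]|%:R)%R%:R)
  <= (N%:R^-1 + 5 / eta) / c ^+ 2.
Proof.
move=> eta1 c0 N0 hq.
have eta0 : 0 < eta by lra.
have i0 : 0 < eta^-1 by rewrite invr_gt0.
have i1 : eta^-1 <= 1 by rewrite invf_le1.
have NR : 0 < N%:R :> R by rewrite ltr0n.
pose Z u g := cutoff tau eta (advantage (graph_of g) A u).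
pose m u := bern_E p (Z u).
have Z0 u g : 0 <= Z u g by apply: cutoff_ge0.
have Z1 u g : Z u g <= 1 by apply: cutoff_le1.
have m0 u : 0 <= m u by rewrite -(bern_E_cst (vpair N) p 0); apply: ler_bern_E.
have m1 u : m u <= 1 by rewrite -[leRHS](bern_E_cst (vpair N) p 1); apply: ler_bern_E.
have mq u : m u <= q.
  by apply: le_trans (hq u); apply: ler_bern_E => // g; apply: cutoff_le_ind.
pose V g := \sum_u (Z u g - m u).
have cN : 0 < (c * N%:R) ^+ 2 by rewrite exprn_gt0 // mulr_gt0.
have step1 : bern_E p (fun g =>
    ((q + c) * N%:R < #|[set u | (advantage (graph_of g) A u <= tau)%R]|%:R)%R%:R)
    <= bern_E p (fun g => ((c * N%:R) ^+ 2)^-1 * V g ^+ 2).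
  apply: ler_bern_E => // g; case: ltrP => h; last first.
    by rewrite mulr_ge0 ?sqr_ge0 // invr_ge0 ltW.
  rewrite mulr1n ler_pdivlMl // mulr1.
  suff hV : c * N%:R <= V g.
    by rewrite lerXn2r ?nnegrE // ?mulr_ge0 ?ltW // (lt_le_trans _ hV) // mulr_gt0.
  rewrite /V sumrB.
  have h1 : \sum_u m u <= q * N%:R.
    apply: (@le_trans _ _ (\sum_(u < N) q)); first exact: ler_sum.
    by rewrite sumr_const card_ord mulr_natr.
  have h2 : #|[set u | (advantage (graph_of g) A u <= tau)%R]|%:R <= \sum_u Z u g.
    rewrite -sum1_card natr_sum big_mkcond; apply: ler_sum => u _.
    by rewrite inE; have := cutoff_ge_ind tau eta0 (advantage (graph_of g) A u); case: ifP.
  lra.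
apply: (le_trans step1); rewrite bern_EZ.
have cov u u' : u != u' -> bern_E p (fun g => Z u g * Z u' g) <= m u * m u' + 5 / eta.
  move=> uu.
  pose W v v' g := cutoff tau eta (advantage_off A v v' g).
  have W0 v v' g : 0 <= W v v' g by apply: cutoff_ge0.
  have ZW v v' g : Z v g <= W v v' g + eta^-1.
    by apply: cutoff_lipschitz => //; apply: advantage_off_close.
  have WZ v v' g : W v v' g <= Z v g + eta^-1.
    by apply: cutoff_lipschitz => //; rewrite distrC; apply: advantage_off_close.
  have EW v v' : bern_E p (W v v') <= m v + eta^-1.
    by rewrite -[X in _ + X](bern_E_cst (vpair N) p) -bern_ED; apply: ler_bern_E.
  have EW0 v v' : 0 <= bern_E p (W v v').
    by rewrite -(bern_E_cst (vpair N) p 0); apply: ler_bern_E.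
  have h1 : bern_E p (fun g => Z u g * Z u' g) <=
      bern_E p (fun g => W u u' g * W u' u g) + 2 / eta.
    rewrite -[X in _ + X](bern_E_cst (vpair N) p) -bern_ED; apply: ler_bern_E => // g.
    have := ZW u u' g; have := ZW u' u g; have := Z0 u g; have := Z1 u g.
    have := Z0 u' g; have := Z1 u' g; have := W0 u u' g; have := W0 u' u g.
    have := cutoff_le1 tau eta (advantage_off A u u' g); rewrite -/(W u u' g).
    move: (Z u g) (Z u' g) (W u u' g) (W u' u g) eta^-1 i0 => a b x y e *.
    have h1 : a * b <= (x + e) * b by apply: ler_wpM2r.
    have h2 : x * b <= x * (y + e) by apply: ler_wpM2l.
    have h3 : x * e <= e by rewrite ler_piMl // ltW.
    have h4 : e * b <= e by rewrite ler_piMr // ltW.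
    lra.
  rewrite (advantage_off_indep A (cutoff tau eta) (cutoff tau eta) uu) in h1.
  have h2 : bern_E p (W u u') * bern_E p (W u' u) <= (m u + eta^-1) * (m u' + eta^-1).
    by apply: ler_pM.
  apply: (le_trans h1); apply: (@le_trans _ _ ((m u + eta^-1) * (m u' + eta^-1) + 2 / eta)).
    by rewrite lerD2r; exact: h2.
  have h3 : m u * eta^-1 <= eta^-1 by rewrite ler_piMl // ltW.
  have h4 : eta^-1 * m u' <= eta^-1 by rewrite ler_piMr // ltW.
  have h5 : eta^-1 * eta^-1 <= eta^-1 by rewrite ler_piMr // ltW.
  lra.
have hV : bern_E p (fun g => V g ^+ 2) <= N%:R + 5 / eta * N%:R ^+ 2.
  have -> : (fun g => V g ^+ 2) = (fun g => \sum_u \sum_u'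
      (Z u g * Z u' g + - m u' * Z u g + - m u * Z u' g + m u * m u')).
    apply: funext => g; rewrite expr2 /V mulr_suml; apply: eq_bigr => u _.
    by rewrite mulr_sumr; apply: eq_bigr => u' _; ring.
  rewrite bern_E_sum.
  apply: (@le_trans _ _ (\sum_(u < N) \sum_(u' < N) ((u == u')%:R + 5 / eta))).
    apply: ler_sum => u _; rewrite bern_E_sum; apply: ler_sum => u' _.
    rewrite !bern_ED !bern_EZ bern_E_cst -/(m u) -/(m u').
    case: (eqVneq u u') => [<-|uu].
      have : bern_E p (fun g => Z u g * Z u g) <= 1.
        rewrite -[leRHS](bern_E_cst (vpair N) p 1); apply: ler_bern_E => // g.
        by rewrite mulr_ile1.
      have : 0 <= 5 / eta by rewrite mulr_ge0 // ltW.
      have : 0 <= m u * m u by rewrite mulr_ge0.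
      rewrite mulr1n; lra.
    have := cov u u' uu; rewrite mulr0n; lra.
  apply: (@le_trans _ _ (\sum_(u < N) (1 + 5 / eta * N%:R))).
    apply: ler_sum => u _; rewrite big_split /= (bigD1 u) //= eqxx big1 ?addr0.
      by rewrite sumr_const card_ord mulr_natr.
    by move=> u' /negbTE hu; rewrite eq_sym hu.
  rewrite sumr_const card_ord mulrnDl expr2 mulrA.
  by rewrite -[X in _ + X]mulr_natr.
apply: (@le_trans _ _ (((c * N%:R) ^+ 2)^-1 * (N%:R + 5 / eta * N%:R ^+ 2))).
  by apply: ler_wpM2l => //; rewrite invr_ge0 ltW.
rewrite le_eqVlt; apply/orP; left; apply/eqP.
by field; rewrite !lt0r_neq0.
Qed.

End Population.

(** * Cuts and greedy steps *)

Section Cuts.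
Context (N : nat) (G : sgraph N).
Implicit Types (A : {set 'I_N}) (v : 'I_N).

Lemma CUT_deg_in A : CUT G A = (\sum_(u in A) deg_in G (~: A) u)%N.
Proof.
rewrite /CUT -sum1_card /deg_in pair_big_dep /=.
rewrite big_mkcond [RHS]big_mkcond; apply: eq_bigr => -[u w] _ /=.
by rewrite !inE /=; case: (u \in A); case: (w \in A); case: (G u w).
Qed.

Lemma CUT_compl A : CUT G (~: A) = CUT G A.
Proof.
rewrite !CUT_deg_in finset.setCK /deg_in exchange_big; apply: eq_bigr => u _.
by apply: eq_bigr => w _; rewrite adj_sym.
Qed.

Lemma deg_inD1 A v : deg_in G (A :\ v) v = deg_in G A v.
Proof.
rewrite /deg_in [LHS]big_mkcond [RHS]big_mkcond; apply: eq_bigr => w _.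
by rewrite !inE; case: eqP => //= ->; rewrite adj_irrefl; case: ifP.
Qed.

(** Both cuts contain the same edges apart from those at v. *)
Lemma CUT_setU1_setD1 A v :
  (CUT G (v |: A) + deg_in G A v = CUT G (A :\ v) + deg_in G (~: A) v)%N.
Proof.
have hv : v \notin A :\ v by rewrite !inE eqxx.
have -> : v |: A = v |: (A :\ v).
  by apply/setP => w; rewrite !inE; case: (w == v).
set A' := A :\ v in hv *; set C := ~: (v |: A').
have eC : ~: A' = v |: C.
  by apply/setP => w; rewrite !inE; case: (w == v) => //=; rewrite orbF.
have vC : v \notin C by rewrite !inE eqxx.
rewrite !CUT_deg_in -/C eC big_setU1 //=.
rewrite -(deg_inD1 A) -/A' -(deg_inD1 (~: A)).
have -> : ~: A :\ v = C.
  by apply/setP => w; rewrite !inE; case: (w == v).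
have -> : (\sum_(u in A') deg_in G (v |: C) u =
    deg_in G A' v + \sum_(u in A') deg_in G C u)%N.
  rewrite -big_split; apply: eq_bigr => u _ /=.
  by rewrite /deg_in big_setU1 //= [G u v]adj_sym.
by rewrite [LHS]addnC [LHS]addnA [LHS]addnAC.
Qed.

(** The vertices that the greedy rule may move or keep out of A; for all others
    the selected vertex ends up in A. *)
Definition unattracted A : {set 'I_N} := [set v | (deg_in G A v <= deg_in G (~: A) v)%N].

Lemma greedy_step_good A v c : v \notin unattracted A -> greedy_step G A v c = v |: A.
Proof.
rewrite inE -ltnNge => h; rewrite /greedy_step.
have := CUT_setU1_setD1 A v; set a := CUT _ _; set b := CUT _ _ => e.
by have -> : (a < b)%N by lia.
Qed.

Lemma greedy_stepP A v c :
  greedy_step G A v c = v |: A \/ greedy_step G A v c = A :\ v.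
Proof.
have hA : A = v |: A \/ A = A :\ v.
  case: (boolP (v \in A)) => h.
    by left; apply/setP => w; rewrite !inE; case: eqP => // ->.
  by right; apply/setP => w; rewrite !inE; case: eqP => // ->; rewrite (negbTE h).
rewrite /greedy_step /move; case: ifP => _; first by left.
case: ifP => _; first by right.
by case: c => //; case: ifP => _; [right|left].
Qed.

Lemma greedy_step_compl A v c : greedy_step G (~: A) v c = ~: greedy_step G A v c.
Proof.
have e1 : v |: ~: A = ~: (A :\ v).
  by apply/setP => w; rewrite !inE; case: eqP.
have e2 : ~: A :\ v = ~: (v |: A).
  by apply/setP => w; rewrite !inE; case: eqP.
rewrite /greedy_step /move e1 e2 !CUT_compl inE.
by case: ltngtP => // _; case: c => //; case: (v \in A).
Qed.

Lemma greedy_search_compl A (v : nat -> 'I_N) c t :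
  greedy_search G (~: A) v c t = ~: greedy_search G A v c t.
Proof. by elim: t => //= t ->; rewrite greedy_step_compl. Qed.

(** greedy_search peels off the last step; this is the same search seen from its
    first step, as the Markov property needs it. *)
Lemma greedy_searchS A (v : nat -> 'I_N) c t :
  greedy_search G A v c t.+1 =
  greedy_search G (greedy_step G A (v 0%N) (c 0%N)) (fun i => v i.+1) (fun i => c i.+1) t.
Proof. by elim: t => //= t ->. Qed.

End Cuts.

(** * The search under a positive drift *)

Section Drift.
Context (R : realType) (N : nat) (G : sgraph N).
Hypothesis (N_gt0 : (0 < N)%N).
Implicit Types (A : {set 'I_N}) (v : 'I_N) (c : nat -> bool).

(** The probability, over the choices of vertices, that the search started from A
    does not end with the full set.  The coins are kept fixed: every bound below
    holds for all of them. *)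
Fixpoint fail_prob n A c : R :=
  if n is m.+1 then
    N%:R^-1 * \sum_x fail_prob m (greedy_step G A x (c 0%N)) (fun i => c i.+1)
  else (A != finset.setT)%:R.

Let NR : 0 < N%:R :> R. Proof. by rewrite ltr0n. Qed.

Lemma fail_prob_le1 n A c : fail_prob n A c <= 1.
Proof.
elim: n A c => [|n IH] A c /=; first by case: (_ != _).
rewrite ler_pdivrMl // mulr1 -[leRHS]/(N%:R : R).
apply: (@le_trans _ _ (\sum_(x < N) 1)); first by apply: ler_sum.
by rewrite sumr_const card_ord.
Qed.

(** Only an unattracted vertex of A can leave A, and only an unattracted vertex
    outside A can fail to join it. *)
Lemma card_step A x (c : bool) : #|A|%:R + ((x \notin A)%:R - (x \in unattracted G A)%:R) <=
  #|greedy_step G A x c|%:R :> R.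
Proof.
have hU : #|x |: A|%:R = #|A|%:R + (x \notin A)%:R :> R.
  by rewrite cardsU1 natrD addrC.
case: (boolP (x \in unattracted G A)) => [_|h]; last first.
  by rewrite greedy_step_good // hU subr0.
case: (greedy_stepP G A x c) => ->.
  by rewrite hU lerD2l gerBl.
rewrite (cardsD1 x A) natrD.
by case: (x \in A) => /=; lra.
Qed.

Lemma sum_step A : 
  \sum_x ((x \notin A)%:R - (x \in unattracted G A)%:R) = #|~: A|%:R - #|unattracted G A|%:R :> R.
Proof.
rewrite sumrB -[#|~: A|]sum1_card -[#|unattracted G A|]sum1_card !natr_sum.
congr (_ - _); rewrite [RHS]big_mkcond; apply: eq_bigr => x _; rewrite ?inE.
  by case: (x \in A).
by case: (_ <= _)%N.
Qed.

(** When no reachable set leaves a vertex unattracted, the expected size of the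
    complement is multiplied by 1 - 1 / N at each step. *)
Lemma fail_prob_end (del : R) n A c :
  (forall A', #|~: A'|%:R <= del -> unattracted G A' = finset.set0) ->
  #|~: A|%:R <= del ->
  fail_prob n A c <= #|~: A|%:R * (1 - N%:R^-1) ^+ n.
Proof.
move=> hend; elim: n A c => [|n IH] A c hA /=.
  rewrite expr0 mulr1; case: eqP => [->|/eqP h] //=.
  rewrite ler_nat card_gt0; apply: contra h => /eqP h.
  by rewrite -[A]finset.setCK h finset.setC0.
rewrite ler_pdivrMl //.
have hb := hend A hA.
have hstep x : #|~: (x |: A)|%:R = #|~: A|%:R - (x \notin A)%:R :> R.
  have : (#|~: A| = (x \in ~: A) + #|~: A :\ x|)%N by rewrite (cardsD1 x).
  have -> : ~: (x |: A) = ~: A :\ x by apply/setP => w; rewrite !inE negb_or.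
  by move=> ->; rewrite inE natrD; ring.
apply: (@le_trans _ _ (\sum_x ((#|~: A|%:R - (x \notin A)%:R) * (1 - N%:R^-1) ^+ n))).
  apply: ler_sum => x _; rewrite greedy_step_good ?hb ?inE // -hstep.
  by apply: IH; rewrite hstep; apply: le_trans hA; rewrite gerBl.
rewrite -mulr_suml sumrB sumr_const card_ord exprS.
have -> : \sum_i (i \notin A)%:R = #|~: A|%:R :> R.
  rewrite -sum1_card natr_sum [RHS]big_mkcond; apply: eq_bigr => x _.
  by rewrite inE; case: (x \in A).
have e : N%:R * N%:R^-1 = 1 :> R by rewrite divff // lt0r_neq0.
rewrite le_eqVlt; apply/orP; left; apply/eqP.
rewrite -[_ *+ N]mulr_natl.
move: e; set i := N%:R^-1; set Q := _ ^+ n; set B := #|_|%:R => e.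
have -> : N%:R * (B * ((1 - i) * Q)) = (N%:R * B - (N%:R * i) * B) * Q by ring.
by rewrite e mul1r.
Qed.

(** One step of the exponential supermartingale: the increment of #|A| has mean at
    least b, so after subtracting b / 2 the linear term wins over the quadratic
    one for th = b / 9. *)
Lemma avg_expR_drift A (b th x : R) : 0 < b -> b <= 1 -> th = b / 9 ->
  #|unattracted G A|%:R + b * N%:R <= #|~: A|%:R ->
  \sum_(v : 'I_N) expR (- (th * ((v \notin A)%:R - (v \in unattracted G A)%:R - b / 2 + x)))
  <= N%:R * expR (- (th * x)).
Proof.
move=> b0 b1 -> hb.
have -> : \sum_(v : 'I_N) expR (- (b / 9 * ((v \notin A)%:R - (v \in unattracted G A)%:R - b / 2 + x))) =
  (\sum_(v : 'I_N) expR (- (b / 9 * ((v \notin A)%:R - (v \in unattracted G A)%:R - b / 2))))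
   * expR (- (b / 9 * x)).
  by rewrite mulr_suml; apply: eq_bigr => v _; rewrite -expRD; congr expR; ring.
apply: ler_wpM2r; first exact: expR_ge0.
apply: (@le_trans _ _ (\sum_(v : 'I_N) (1 + b / 9 * (b / 2) + b / 9 * (b / 2) +
    - (b / 9) * ((v \notin A)%:R - (v \in unattracted G A)%:R)))).
  apply: ler_sum => v _; set y := (v \notin A)%:R - (v \in unattracted G A)%:R.
  have [y1 y2] : -1 <= y /\ y <= 1.
    rewrite /y; case: (_ \notin _); case: (_ \in _); rewrite ?mulr0n ?mulr1n; split; lra.
  have h : - (b / 9 * (y - b / 2)) <= 2^-1 by nra.
  apply: (le_trans (expR_le_quadratic h)).
  have : (y - b / 2) ^+ 2 <= (3 / 2) ^+ 2.
    have e1 : 0 <= 3 / 2 - (y - b / 2) by lra.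
    have e2 : 0 <= 3 / 2 + (y - b / 2) by lra.
    by have := mulr_ge0 e1 e2; rewrite !expr2; lra.
  have b2 : 0 <= 2 * (b / 9) ^+ 2 by rewrite mulr_ge0 // sqr_ge0.
  move=> /(ler_wpM2l b2) hz.
  have -> : (- (b / 9 * (y - b / 2))) ^+ 2 = (b / 9) ^+ 2 * (y - b / 2) ^+ 2 by ring.
  by move: hz; set z := (y - _) ^+ 2; rewrite !expr2; lra.
rewrite big_split /= sumr_const card_ord -mulr_sumr sum_step -mulr_natr.
have := ler_wpM2l (ltW b0) hb; lra.
Qed.

Lemma card_symdiff_step A A0 v (c : bool) :
  (#|greedy_step G A v c :\: A0| + #|A0 :\: greedy_step G A v c| <=
   1 + (#|A :\: A0| + #|A0 :\: A|))%N.
Proof.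
have h1 : (#|(v |: A) :\: A0| + #|A0 :\: (v |: A)| <= 1 + (#|A :\: A0| + #|A0 :\: A|))%N.
  rewrite addnA leq_add //; last first.
    by rewrite subset_leq_card // finset.setDS // finset.subsetUr.
  apply: (@leq_trans #|v |: (A :\: A0)|); last by rewrite cardsU1 leq_add2r; case: (_ \in _).
  apply: subset_leq_card; apply/fintype.subsetP => w; rewrite !inE.
  by case: (w == v); case: (w \in A); case: (w \in A0).
have h2 : (#|(A :\ v) :\: A0| + #|A0 :\: (A :\ v)| <= 1 + (#|A :\: A0| + #|A0 :\: A|))%N.
  rewrite addnCA leq_add //.
    by rewrite subset_leq_card // finset.setSD // finset.subsetDl.
  apply: (@leq_trans #|v |: (A0 :\: A)|); last by rewrite cardsU1 leq_add2r; case: (_ \in _).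
  apply: subset_leq_card; apply/fintype.subsetP => w; rewrite !inE.
  by case: (w == v); case: (w \in A); case: (w \in A0).
by case: (greedy_stepP G A v c) => ->.
Qed.

(** Optional stopping.  The search is followed until it crosses the barrier
    #|A0| + b t / 2 - x, where the exponential reaches 1, or until the complement
    has at most del elements, where fail_prob_end applies.  At distance t from A0
    only the sets within t moves of A0 have to satisfy the drift condition. *)
Lemma fail_prob_drift A0 (b th x del : R) L L' :
  0 < b -> b <= 1 -> th = b / 9 -> 0 < x ->
  (forall A', #|~: A'|%:R <= del -> unattracted G A' = finset.set0) ->
  (forall t A, (#|A :\: A0| + #|A0 :\: A| <= t)%N ->
     #|A0|%:R + b / 2 * t%:R - x <= #|A|%:R -> del < #|~: A|%:R ->
     #|unattracted G A|%:R + b * N%:R <= #|~: A|%:R) ->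
  N%:R < #|A0|%:R + b / 2 * L%:R - x ->
  forall n t A c, (t + n = L + L')%N -> (t <= L)%N ->
    (#|A :\: A0| + #|A0 :\: A| <= t)%N ->
    fail_prob n A c <=
      expR (- (th * (#|A|%:R - #|A0|%:R - b / 2 * t%:R + x))) +
      N%:R * (1 - N%:R^-1) ^+ L'.
Proof.
move=> b0 b1 hth x0 hend hdrift hL.
have N1 : 0 <= 1 - N%:R^-1 :> R by rewrite subr_ge0 invf_le1 // ler1n.
have Ni : 1 - N%:R^-1 <= 1 :> R by rewrite gerBl invr_ge0 ltW.
have th0 : 0 < th by lra.
pose bar t A := expR (- (th * (#|A|%:R - #|A0|%:R - b / 2 * t%:R + x))).
pose tail : R := N%:R * (1 - N%:R^-1) ^+ L'.
have bar0 t A : 0 <= bar t A by exact: expR_ge0.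
have tail0 : 0 <= tail by rewrite mulr_ge0 ?exprn_ge0.
have cardle A : #|A|%:R <= N%:R :> R by rewrite ler_nat -[leqRHS](card_ord N) max_card.
have ended n t A c : (t + n = L + L')%N -> (t <= L)%N -> #|~: A|%:R <= del ->
    fail_prob n A c <= bar t A + tail.
  move=> htn tL hdel; apply: (le_trans (fail_prob_end n c hend hdel)).
  apply: (@le_trans _ _ tail); last by rewrite lerDr.
  have hn : (L' <= n)%N by rewrite -(leq_add2l L) -htn leq_add2r.
  by apply: ler_pM; rewrite ?exprn_ge0 // ler_wiXn2l.
(* Below the barrier the exponential is at least 1. *)
have crossed n t A c : #|A|%:R < #|A0|%:R + b / 2 * t%:R - x ->
    fail_prob n A c <= bar t A + tail.
  move=> hbar; apply: (le_trans (fail_prob_le1 n A c)).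
  apply: (@le_trans _ _ (bar t A)); last by rewrite lerDl.
  by rewrite -[leLHS]expR0 ler_expR oppr_ge0 pmulr_rle0 //; lra.
(* The choice of L puts the barrier above N at time L. *)
have before_L t A : #|A0|%:R + b / 2 * t%:R - x <= #|A|%:R -> (t <= L)%N -> (t < L)%N.
  move=> hbar; rewrite leq_eqVlt => /orP[/eqP eL|//].
  by rewrite eL in hbar; have := cardle A; lra.
elim=> [|n IH] t A c htn tL hA; rewrite -/(bar t A) -/tail;
  (have [hdel|hdel] := lerP #|~: A|%:R del; first exact: ended hdel);
  (have [hbar|hbar] := lerP (#|A0|%:R + b / 2 * t%:R - x) #|A|%:R; last exact: crossed hbar);
  have tL' := before_L t A hbar tL.
  by move: tL'; rewrite -(addn0 t) htn ltnNge leq_addr.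
have hb := hdrift t A hA hbar hdel.
rewrite /= ler_pdivrMl //.
pose d := #|A|%:R - #|A0|%:R - b / 2 * t%:R + x.
apply: (@le_trans _ _ (\sum_(v : 'I_N)
   (expR (- (th * ((v \notin A)%:R - (v \in unattracted G A)%:R - b / 2 + d))) + tail))).
  apply: ler_sum => v _.
  have hA' : (#|greedy_step G A v (c 0%N) :\: A0| +
       #|A0 :\: greedy_step G A v (c 0%N)| <= t.+1)%N.
    apply: leq_trans (_ : (1 + (#|A :\: A0| + #|A0 :\: A|) <= _)%N); last by rewrite add1n ltnS.
    by apply: card_symdiff_step.
  apply: (le_trans (IH t.+1 _ _ _ _ hA')) => //; first by rewrite addSnnS.
  rewrite lerD2r /bar ler_expR lerN2 ler_pM2l // /d.
  have := card_step A v (c 0%N); rewrite -[t.+1%:R]natr1; lra.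
rewrite big_split /= sumr_const card_ord mulrDr -[tail *+ N]mulr_natl lerD2r.
by apply: (avg_expR_drift _ b0 b1 hth hb).
Qed.
End Drift.

(** * Positive drift on a regular graph *)

Section RegularDrift.
Context (R : realType) (p : R) (N : nat) (G : sgraph N).
Hypothesis (p_gt0 : 0 < p).
Implicit Types (A K S : {set 'I_N}).

Lemma deg_inU S S' u : [disjoint S & S'] ->
  deg_in G (S :|: S') u = (deg_in G S u + deg_in G S' u)%N.
Proof.
by move=> h; rewrite /deg_in -bigU //; apply: eq_bigl => w; rewrite !inE.
Qed.

Lemma deg_in_split S A u :
  deg_in G S u = (deg_in G (S :&: A) u + deg_in G (S :\: A) u)%N.
Proof.
rewrite -[in LHS](finset.setID S A) deg_inU //.
by rewrite finset.disjoints_subset; apply/fintype.subsetP => w; rewrite !inE => /andP[_ ->].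
Qed.

Lemma deg_in_le_card S u : (deg_in G S u <= #|S|)%N.
Proof. by rewrite -sum1_card; apply: leq_sum => w _; case: (G u w). Qed.

Lemma jumbled_ge lam K S : jumbled p lam G ->
  p * (#|K|%:R * #|S|%:R - #|K|%:R) - (4 * lam * (#|K|%:R * #|S|%:R) + 3 * N%:R / lam)
  <= edges_between R G K S.
Proof.
move=> /forallP/(_ K)/forallP/(_ S); rewrite ler_norml /deviation => /andP[h _].
have := ler_wpM2l (ltW p_gt0) (edges_between_complete_ge R K S); lra.
Qed.

Lemma jumbled_le lam K S : jumbled p lam G ->
  edges_between R G K S <=
  p * (#|K|%:R * #|S|%:R) + (4 * lam * (#|K|%:R * #|S|%:R) + 3 * N%:R / lam).
Proof.
move=> /forallP/(_ K)/forallP/(_ S); rewrite ler_norml /deviation => /andP[_ h].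
have := ler_wpM2l (ltW p_gt0) (edges_between_complete_le R K S); lra.
Qed.

Lemma cardC_real A : #|~: A|%:R = N%:R - #|A|%:R :> R.
Proof.
by have /(congr1 (fun n => n%:R : R)) := cardsC A; rewrite card_ord natrD; lra.
Qed.

(** The unattracted vertices send at least as many edges out of A as into A, which
    contradicts jumbledness when they are many and A is much larger than its
    complement. *)
Lemma card_unattracted_jumbled lam A : jumbled p lam G ->
  p * #|unattracted G A|%:R * (2 * #|A|%:R - N%:R - 1) <=
  4 * lam * #|unattracted G A|%:R * N%:R + 6 * N%:R / lam.
Proof.
move=> hJ; set K := unattracted G A.
have h : edges_between R G K A <= edges_between R G K (~: A).
  by apply: ler_sum => u; rewrite inE ler_nat.
have := jumbled_ge K A hJ; have := jumbled_le K (~: A) hJ.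
rewrite cardC_real; lra.
Qed.

(** Vertices entering A count twice: they are gained on one side and lost on the
    other. *)
Lemma advantage_change A A0 u :
  advantage R G A u = advantage R G A0 u +
    2 * ((deg_in G (A :\: A0) u)%:R - (deg_in G (A0 :\: A) u)%:R).
Proof.
rewrite /advantage (deg_in_split A A0) (deg_in_split A0 A) finset.setIC.
rewrite (deg_in_split (~: A) A0) (deg_in_split (~: A0) A).
have -> : ~: A :&: A0 = A0 :\: A by rewrite finset.setDE finset.setIC.
have -> : ~: A0 :&: A = A :\: A0 by rewrite finset.setDE finset.setIC.
have -> : ~: A :\: A0 = ~: A0 :\: A by rewrite !finset.setDE finset.setIC.
by rewrite !natrD; ring.
Qed.

Lemma card_change A A0 :
  #|A|%:R - #|A0|%:R = #|A :\: A0|%:R - #|A0 :\: A|%:R :> R.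
Proof.
by rewrite -(cardsID A0 A) -(cardsID A A0) finset.setIC !natrD; ring.
Qed.

(** The vertices whose advantage was above tau and vanished must have lost it to the
    few vertices that moved; jumbledness limits their number. *)
Lemma card_newly_unattracted lam A A0 (tau : R) : jumbled p lam G ->
  #|[set u in unattracted G A | tau < advantage R G A0 u]|%:R *
    (tau + 2 * p * (#|A|%:R - #|A0|%:R) - 2 * p) <=
  2 * (4 * lam * #|[set u in unattracted G A | tau < advantage R G A0 u]|%:R *
        (#|A :\: A0|%:R + #|A0 :\: A|%:R) + 6 * N%:R / lam).
Proof.
move=> hJ; set K := [set u in _ | _].
have h : tau * #|K|%:R + 2 * (edges_between R G K (A :\: A0) -
    edges_between R G K (A0 :\: A)) <= 0.
  rewrite /edges_between -sumrB mulr_sumr mulr_natr -sumr_const -big_split /=.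
  apply: sumr_le0 => u; rewrite inE inE => /andP[hb ht].
  have := advantage_change A A0 u; rewrite {1}/advantage.
  have : (deg_in G A u)%:R <= (deg_in G (~: A) u)%:R :> R by rewrite ler_nat.
  lra.
rewrite card_change.
have := jumbled_ge K (A :\: A0) hJ; have := jumbled_le K (A0 :\: A) hJ; lra.
Qed.

Lemma unattracted_small_complement A : (4 <= N)%N -> min_degree_ok p G ->
  #|~: A|%:R <= p / 8 * N%:R -> unattracted G A = finset.set0.
Proof.
move=> N4 /forallP hd hA; apply/setP => u; rewrite !inE; apply/negbTE.
rewrite -ltnNge -(ltr_nat R).
have := hd u; rewrite (deg_in_split _ A) finset.setTI finset.setTD natrD.
have h1 : (deg_in G (~: A) u)%:R <= p / 8 * N%:R.
  by apply: le_trans hA; rewrite ler_nat deg_in_le_card.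
have h2 : N.-1%:R = N%:R - 1 :> R by rewrite -[in RHS](ltn_predK N4) -natr1 addrK.
have h3 : p * 4 <= p * N%:R by apply: ler_wpM2l; [exact: ltW|rewrite ler_nat].
rewrite h2; move: (p_gt0) => ?; lra.
Qed.

(** The barrier forces the imbalance to be at least X s / 2 + b t.  After K' s steps
    this is a large multiple of s, and card_unattracted_jumbled applies with
    lam = 1 / (4 s).  Before that, card_newly_unattracted applies with
    tau = 3/4 p X s, of which the moved vertices take back at most p X s / 2 in the
    mean. *)
Lemma drift_of_regular A0 (X b K' lam s : R) t A :
  0 < X -> 0 < b -> b <= p / 16 -> s ^+ 2 = N%:R -> 1 <= s ->
  b * K' = (20 / p) ^+ 2 + 1 ->
  0 < lam -> 8 * 16 * (lam * K') <= p * X * b ->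
  12 * 16 <= lam * p * X * b * s -> 16 <= X * s -> 2 * K' <= b * s ->
  jumbled p (4 * s)^-1 G -> jumbled p lam G ->
  X * s <= 2 * #|A0|%:R - N%:R -> 2 * #|A0|%:R - N%:R <= b * N%:R ->
  #|[set u | (advantage R G A0 u <= 3 / 4 * p * X * s)%R]|%:R <= (2^-1 - 4 * b) * N%:R ->
  (#|A :\: A0| + #|A0 :\: A| <= t)%N ->
  #|A0|%:R + b / 2 * t%:R - X * s / 4 <= #|A|%:R ->
  p / 8 * N%:R < #|~: A|%:R ->
  #|unattracted G A|%:R + b * N%:R <= #|~: A|%:R.
Proof.
move=> X0 b0 bp sN s1 hK' lam0 hlam hs1 hs2 hs3 hJ1 hJ2 hA01 hA02 hpop hdist hbar hend.
have s0 : 0 < s by lra.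
have K'0 : 0 <= K'.
  have h400 : 0 <= (20 / p) ^+ 2 by exact: sqr_ge0.
  by rewrite -(pmulr_rge0 _ b0) hK' addr_ge0.
have NR : 0 < N%:R :> R by rewrite -sN exprn_gt0.
have cardle S : #|S|%:R <= N%:R :> R by rewrite ler_nat -[leqRHS](card_ord N) max_card.
(* The second case compares A with A0 and uses the hypothesis on advantages. *)
have [late|early] := lerP (K' * s) t%:R.
-   clear hs1 hs2 hs3 hlam hpop hJ2 hA02 hdist lam0.
  have h := card_unattracted_jumbled A hJ1.
  set k := #|unattracted G A|%:R in h *.
  have k0 : 0 <= k by [].
  have hk : k * N%:R <= N%:R * N%:R by apply: ler_wpM2r; [exact: ltW|exact: cardle].
  have e1 : 6 * N%:R / (4 * s)^-1 = 24 * (N%:R * s) by rewrite invrK; ring.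
  have e2 : 4 * (4 * s)^-1 * k * N%:R = k * s.
    by rewrite -sN; field; lra.
  have e3 : k * s <= N%:R * s by apply: ler_wpM2r; [lra|exact: cardle].
  (* The barrier turns t >= K' s into an imbalance of at least b K' s. *)
  have hD : b * K' * s - 1 <= 2 * #|A|%:R - N%:R - 1.
    have : b * (K' * s) <= b * t%:R by rewrite ler_pM2l.
    have : 0 <= X * s by rewrite mulr_ge0 // ltW.
    lra.
  have hD' : (20 / p) ^+ 2 * s <= 2 * #|A|%:R - N%:R - 1 by rewrite hK' in hD; lra.
  have pk0 : 0 <= p * k by rewrite mulr_ge0 // ltW.
  have h4 := le_trans (ler_wpM2l pk0 hD') h.
  have e4 : p * k * ((20 / p) ^+ 2 * s) = 20 * 20 * k / p * s by field; lra.
  rewrite e4 e1 e2 in h4.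
  have h5 : 20 * 20 * k / p * s <= 25 * N%:R * s by lra.
  rewrite ler_pM2r // ler_pdivrMr // in h5.
  have : b * N%:R <= p / 16 * N%:R by rewrite ler_pM2r.
  lra.
-   clear hK' hJ1 bp.
  have h := card_newly_unattracted A A0 (3 / 4 * p * X * s) hJ2.
  set K := [set u in _ | _] in h *.
  have k0 : 0 <= #|K|%:R :> R by [].
  have hcover : #|unattracted G A|%:R <=
      #|[set u | (advantage R G A0 u <= 3 / 4 * p * X * s)%R]|%:R + #|K|%:R :> R.
    rewrite -natrD ler_nat; apply: leq_trans (leq_card_setU _ _).
    apply: subset_leq_card; apply/fintype.subsetP => u hu; rewrite !inE.
    by case: lerP => //= _; rewrite inE in hu; rewrite hu.
  clearbody K.
  have hdistR : #|A :\: A0|%:R + #|A0 :\: A|%:R <= K' * s.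
    by apply: ltW; apply: le_lt_trans early; rewrite -natrD ler_nat.
  have bt0 : 0 <= b / 2 * t%:R by rewrite mulr_ge0 // divr_ge0 // ltW.
  have hx : - (X * s / 4) <= #|A|%:R - #|A0|%:R by lra.
  have h1 : #|K|%:R * (p * X * s / 8) <= #|K|%:R * (3 / 4 * p * X * s +
      2 * p * (#|A|%:R - #|A0|%:R) - 2 * p).
    apply: ler_wpM2l => //.
    have p2 : 0 <= 2 * p by rewrite mulr_ge0 // ltW.
    have := ler_wpM2l p2 hx; have := ler_wpM2l (ltW p_gt0) hs2; lra.
  have l4 : 0 <= 4 * lam * #|K|%:R by rewrite mulr_ge0 // mulr_ge0 // ltW.
  have h2 := ler_wpM2l l4 hdistR.
  have l5 : 0 <= 4 * lam * (K' * s) by rewrite !mulr_ge0 // ltW.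
  have h3 := ler_wpM2l l5 (cardle K).
  have h4 : #|K|%:R * (p * X * s / 8) <= 2 * (4 * lam * (K' * s) * N%:R + 6 * N%:R / lam).
    lra.
  clear h h1 h2 h3 hx l4 l5 bt0.
  (* lam is small enough for this term, and s large enough for the next one. *)
  have h5 : 2 * (4 * lam * (K' * s) * N%:R) <= b / 2 * N%:R * (p * X * s / 8).
    have sN0 : 0 <= s * N%:R / 16 by rewrite !mulr_ge0 // ltW.
    have := ler_wpM2r sN0 hlam; lra.
  have h6 : 2 * (6 * N%:R / lam) <= b / 2 * N%:R * (p * X * s / 8).
    rewrite mulrA ler_pdivrMr //.
    have := ler_wpM2r (ltW NR) hs1; lra.
  have h7 : #|K|%:R <= b * N%:R.
    have q0 : 0 < p * X * s / 8 by rewrite !mulr_gt0.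
    rewrite -(ler_pM2r q0); lra.
  have h8 : #|A0|%:R + K' * s >= #|A|%:R.
    have := card_change A A0; have : 0 <= #|A0 :\: A|%:R :> R by []; lra.
  have h9 : K' * s <= b / 2 * N%:R.
    rewrite -sN expr2; have := ler_wpM2r (ltW s0) hs3; lra.
  rewrite cardC_real; have : 0 <= b * N%:R by rewrite mulr_ge0 // ltW.
  lra.
Qed.

End RegularDrift.

(** * Anticoncentration of the initial imbalance *)

Lemma central_binS n : (n.+1 * 'C(n.+1.*2, n.+1) = 2 * (n.*2.+1 * 'C(n.*2, n)))%N.
Proof.
rewrite doubleS binS.
have -> : 'C(n.*2.+1, n) = 'C(n.*2.+1, n.+1).
  by rewrite -bin_sub; [congr binomial; lia|lia].
have := mul_bin_diag n.*2.+1 n; rewrite /= => ->; lia.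
Qed.

Lemma central_bin_le n : ('C(n.*2, n) ^ 2 * n.*2.+1 <= 4 ^ n.*2)%N.
Proof.
elim: n => [|n IH] //.
have e := central_binS n.
rewrite -(@leq_pmul2l (n.+1 ^ 2)) // mulnA -expnMn e.
rewrite doubleS 2!expnS.
move: IH; set c := 'C(_, _); set x := (4 ^ _)%N => IH.
have := leq_mul (leqnn (4 * (n.*2.+1 * n.*2.+3))%N) IH.
have h : (n.*2.+1 * n.*2.+3 <= 4 * n.+1 ^ 2)%N by rewrite -!muln2; lia.
have := leq_mul h (leqnn (4 * x)%N).
rewrite !expnS !expn0; lia.
Qed.

Lemma bin_le_central n k : ('C(n.*2, k) <= 'C(n.*2, n))%N.
Proof.
have low j : (j <= n)%N -> ('C(n.*2, n - j) <= 'C(n.*2, n))%N.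
  elim: j => [|j IH] hj; first by rewrite subn0.
  apply: leq_trans (IH (ltnW hj)).
  have hk : (n - j = (n - j.+1).+1)%N by lia.
  rewrite hk -(@leq_pmul2l (n - j.+1).+1) // mul_bin_left.
  by rewrite leq_mul2r; apply/orP; right; lia.
have [h|h] := leqP k n.
  by have := low (n - k)%N (leq_subr _ _); rewrite subKn.
have [h2|h2] := leqP k n.*2; last by rewrite bin_small.
rewrite -bin_sub //; have h3 : (n.*2 - k <= n)%N by lia.
by have := low (n - (n.*2 - k))%N (leq_subr _ _); rewrite subKn.
Qed.

(** That is, no binomial coefficient exceeds 2^N divided by the square root of N. *)
Lemma bin_sqr_le N k : ('C(N, k) ^ 2 * N <= 4 ^ N)%N.
Proof.
rewrite -(odd_double_half N); set n := N./2; case: (odd N); last first.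
  rewrite add0n; apply: leq_trans (central_bin_le n).
  by rewrite leq_mul // leq_exp2r // bin_le_central.
rewrite add1n [(4 ^ _)%N]expnS.
have h : ('C(n.*2.+1, k) <= 2 * 'C(n.*2, n))%N.
  case: k => [|k]; first by rewrite bin0 muln_gt0 bin_gt0 -addnn leq_addr.
  by rewrite binS mulSn mul1n leq_add // bin_le_central.
apply: (@leq_trans ((2 * 'C(n.*2, n)) ^ 2 * n.*2.+1)%N).
  by rewrite leq_pmul2r // leq_exp2r.
by rewrite expnMn -mulnA leq_pmul2l // central_bin_le.
Qed.

Lemma count_interval (R : realType) (x y : R) n : x <= y ->
  \sum_(k < n) ((x < k%:R) && (k%:R < y))%:R <= y - x + 1.
Proof.
move=> xy.
have : \sum_(k < n) ((x < k%:R) && (k%:R < y))%:R <= Num.max 0 (Num.min n%:R (y + 1) - x).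
  elim: n => [|n IH]; first by rewrite big_ord0 le_max lexx.
  rewrite big_ord_recr /= -[n.+1%:R]natr1.
  move: IH; set S := \sum_(_ < n) _; rewrite /Num.max /Num.min.
  case: (ltrP n%:R (y + 1)) => h1; case: (ltrP (n%:R + 1) (y + 1)) => h2;
  case: (ltrP x n%:R) => h3; case: (ltrP n%:R y) => h4 /=; rewrite ?mulr0n ?mulr1n;
  case: ltrP => h5; case: ltrP => h6; lra.
move=> h; apply: (le_trans h); rewrite /Num.max /Num.min.
by case: (ltrP n%:R (y + 1)) => h1; case: ltrP => h2; lra.
Qed.

Section Initial.
Context (R : realType) (N : nat).
Implicit Types (a : {ffun 'I_N -> bool}) (A : {set 'I_N}).

Definition chosen_set a : {set 'I_N} := [set i | a i].

Lemma card_chosen_set a : #|chosen_set a| = (\sum_i a i)%N.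
Proof.
rewrite -sum1_card big_mkcond; apply: eq_bigr => i _.
by rewrite inE; case: (a i).
Qed.

Lemma bern_E_half (F : {set 'I_N} -> R) :
  bern_E 2^-1 (fun a => F (chosen_set a)) = (2 ^+ N)^-1 * \sum_A F A.
Proof.
rewrite /bern_E mulr_sumr [RHS](reindex_onto chosen_set (fun A => [ffun i => i \in A])) /=; last first.
  by move=> A _; apply/setP => i; rewrite inE ffunE.
apply: eq_big => [a|a _].
  by apply/esym/eqP/ffunP => i; rewrite ffunE inE.
congr (_ * _); rewrite /bern_wt (eq_bigr (fun=> 2^-1)); last first.
  by move=> i _; case: (a i) => //; lra.
by rewrite prodr_const card_ord exprVn.
Qed.

(** At most X s + 1 values of #|A| are that close to N / 2, and each has probability
    at most 1 / s. *)
Lemma initial_spread (X s : R) : 0 <= X -> 0 < s -> s ^+ 2 = N%:R ->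
  bern_E 2^-1 (fun a => (`|2 * #|chosen_set a|%:R - N%:R| < X * s)%R%:R) <= X + s^-1.
Proof.
move=> X0 s0 sN.
rewrite (bern_E_half (fun A => (`|2 * #|A|%:R - N%:R| < X * s)%R%:R)).
have -> : \sum_A (`|2 * #|A : {set 'I_N}|%:R - N%:R| < X * s)%R%:R =
   \sum_(k < N.+1) 'C(N, k)%:R * (`|2 * k%:R - N%:R| < X * s)%R%:R :> R.
  rewrite (partition_big (fun A : {set 'I_N} => inord #|A| : 'I_N.+1) predT) //=.
  apply: eq_bigr => k _.
  have cA (A : {set 'I_N}) : (inord #|A| == k) = (#|A| == k :> nat).
    have hA : (#|A| < N.+1)%N by rewrite ltnS -[leqRHS](card_ord N) max_card.
    apply/eqP/eqP => [<-|e]; first by rewrite inordK.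
    by apply: val_inj; rewrite /= inordK.
  rewrite (eq_bigl _ _ cA) (eq_bigr (fun=> (`|2 * k%:R - N%:R| < X * s)%R%:R)); last first.
    by move=> A /eqP ->.
  rewrite sumr_const [RHS]mulr_natl; congr (_ *+ _).
  have := card_draws 'I_N k; rewrite card_ord => <-; apply: eq_card => A.
  by rewrite inE unfold_in.
(* Each value of #|A| has probability at most 1 / s. *)
have hC k : 'C(N, k)%:R <= 2 ^+ N / s :> R.
  rewrite ler_pdivlMr //.
  rewrite -ler_sqr ?nnegrE ?mulr_ge0 ?exprn_ge0 ?(ltW s0) //.
  have -> : (2 ^+ N) ^+ 2 = (4 ^ N)%:R :> R.
    by rewrite natrX -exprM mulnC exprM -natrX.
  by rewrite exprMn sN -natrX -natrM ler_nat bin_sqr_le.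
apply: (@le_trans _ _ ((2 ^+ N)^-1 * \sum_(k < N.+1) (2 ^+ N / s *
    (((N%:R - X * s) / 2 < k%:R) && (k%:R < (N%:R + X * s) / 2))%:R))).
  rewrite ler_pM2l ?invr_gt0 ?exprn_gt0 //; apply: ler_sum => k _.
  apply: ler_pM => //; rewrite ler_nat.
  case: ltrP => // h; move: h; rewrite ltr_norml => /andP[h1 h2].
  have -> : (N%:R - X * s) / 2 < k%:R by lra.
  by have -> : k%:R < (N%:R + X * s) / 2 by lra.
rewrite -mulr_sumr !mulrA mulVf ?lt0r_neq0 ?exprn_gt0 // mul1r.
have Xs0 : 0 <= X * s by rewrite mulr_ge0 // ltW.
have hxy : (N%:R - X * s) / 2 <= (N%:R + X * s) / 2 by lra.
have i0 : 0 <= s^-1 by rewrite invr_ge0 ltW.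
apply: (le_trans (ler_wpM2l i0 (count_interval N.+1 hxy))).
rewrite le_eqVlt; apply/orP; left; apply/eqP; field; exact: lt0r_neq0.
Qed.

Lemma initial_balance (b : R) : 0 < b -> b <= 1 ->
  bern_E 2^-1 (fun a => (b * N%:R < `|2 * #|chosen_set a|%:R - N%:R|)%R%:R) <=
  2 * expR (- (b ^+ 2 / 32 * N%:R)).
Proof.
move=> b0 b1.
pose t := b * N%:R / 2.
have h0 : 0 <= 2^-1 :> R by [].
have h1 : 2^-1 <= 1 :> R by lra.
have l0 : 0 <= b / 8 by lra.
have tailbound (sg : R) : `|sg| = 1 ->
    bern_E 2^-1 (fun a : {ffun 'I_N -> bool} => (t <= \sum_i sg * ((a i)%:R - 2^-1))%R%:R)
    <= expR (- (b ^+ 2 / 32 * N%:R)).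
  move=> hsg.
  apply: (le_trans (bern_chernoff (a := fun=> sg) t h0 h1 l0 _)).
    by move=> i; rewrite hsg mulr1; lra.
  have -> : sg ^+ 2 = 1 by rewrite -real_normK ?num_real // hsg expr1n.
  rewrite sumr_const card_ord ler_expR /t !expr2; lra.
apply: (@le_trans _ _ (bern_E 2^-1 (fun a : {ffun 'I_N -> bool} =>
   (t <= \sum_i 1 * ((a i)%:R - 2^-1))%R%:R +
   (t <= \sum_i (-1) * ((a i)%:R - 2^-1))%R%:R))).
  apply: ler_bern_E => // a.
  rewrite -!mulr_sumr mul1r mulN1r sumrB -natr_sum -card_chosen_set sumr_const card_ord.
  rewrite -[2^-1 *+ N]mulr_natr /t.
  case: (ltrP (b * N%:R)) => h; last by rewrite addr_ge0.
  move: h; case: (lerP (0 : R) (2 * #|chosen_set a|%:R - N%:R)) => hs.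
    rewrite ger0_norm // => h.
    have -> : b * N%:R / 2 <= #|chosen_set a|%:R - 2^-1 * N%:R by lra.
    by rewrite lerDl.
  rewrite ltr0_norm // => h.
  have -> : b * N%:R / 2 <= - (#|chosen_set a|%:R - 2^-1 * N%:R) by lra.
  by rewrite lerDr.
rewrite bern_ED -[2]/(1 + 1) mulrDl !mul1r.
by apply: lerD; apply: tailbound; rewrite ?normrN ?normr1.
Qed.

End Initial.

(** * Most vertices favour the larger initial side *)

(** Here tau = 3/4 p X s and the cutoff ends at 7/8 p X s, while the mean of the
    advantage is at least p (X s - 1); binomE_biased is used with y = p X s / 16. *)
Lemma population_biased (R : realType) (p : R) (N : nat) (A : {set 'I_N})
    (X s : R) (M : nat) :
  0 < p -> p <= 1 -> 0 < X -> 0 < s -> s ^+ 2 = N%:R ->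
  32 < M%:R * (p * X) -> 64 <= X * s -> 8 * 16 * (8 * 16 * M%:R) <= p ^+ 2 * X * s ->
  X * s <= 2 * #|A|%:R - N%:R ->
  bern_E p (fun g => (((2^-1 - (8 * M%:R)^-1 : R) * N%:R : R) <
    #|[set u | (advantage R (graph_of g) A u <= 3 / 4 * p * X * s)%R]|%:R)%R%:R)
  <= (N%:R^-1 + 40 / (p * X * s)) * (64 * M%:R ^+ 2).
Proof.
move=> p0 p1 X0 s0 sN hM hs1 hs2 hA.
have N0 : (0 < N)%N by rewrite -(ltr_nat R) -sN exprn_gt0.
have M0 : 0 < M%:R :> R.
  by rewrite -(pmulr_lgt0 _ (mulr_gt0 p0 X0)); apply: lt_trans hM.
have pXs : 0 < p * X * s by rewrite !mulr_gt0.
have c0 : 0 < (8 * M%:R)^-1 :> R by rewrite invr_gt0 mulr_gt0.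
have eta1 : 1 <= p * X * s / 8.
  have M1 : 1 <= M%:R :> R by rewrite (ler_nat R 1) -(ltr_nat R).
  have : p ^+ 2 * X * s <= p * X * s.
    rewrite expr2 -!mulrA ler_piMl // !mulr_ge0 ?ltW //.
  lra.
have := @population_concentration R p N (ltW p0) p1 A (3 / 4 * p * X * s) (p * X * s / 8)
  (2^-1 - (4 * M%:R)^-1) (8 * M%:R)^-1 eta1 c0 N0.
have -> : 2^-1 - (4 * M%:R)^-1 + (8 * M%:R)^-1 = 2^-1 - (8 * M%:R)^-1 :> R.
  by field; lra.
have -> : (N%:R^-1 + 5 / (p * X * s / 8)) / (8 * M%:R)^-1 ^+ 2 =
   (N%:R^-1 + 40 / (p * X * s)) * (64 * M%:R ^+ 2) :> R.
  congr (_ * _); last by rewrite exprVn invrK exprMn; congr (_ * _); lra.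
  by congr (_ + _); field; rewrite ?lt0r_neq0.
apply=> u.
rewrite (bern_E_advantage p A u (fun x => (x <= 3 / 4 * p * X * s + p * X * s / 8)%R%:R)).
set a := #|A :\ u|; set b := #|~: A :\ u|.
have ha : #|A|%:R - 1 <= a%:R :> R.
  by rewrite lerBlDr natr1 ler_nat (cardsD1 u A) addnC -addn1 leq_add2l; case: (_ \in _).
have hb : b%:R <= N%:R - #|A|%:R :> R.
  by rewrite -cardC_real ler_nat subset_leq_card // finset.subsetDl.
have hba : (b <= a)%N by rewrite -(ler_nat R); lra.
have hm : X * s - 1 <= (a - b)%:R by rewrite natrB //; lra.
have y0 : 0 < p * X * s / 16 by lra.
have hbs : b%:R <= s ^+ 2.
  by rewrite sN; apply: (le_trans hb); rewrite gerBl.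
have hMy : 2 * s < M%:R * (p * X * s / 16).
  have := hM; rewrite -(ltr_pM2r s0); lra.
(* 3/4 + 1/8 + 1/16 = 15/16, and X s <= m + 1 for m = a - b. *)
have htau : 3 / 4 * p * X * s + p * X * s / 8 + p * X * s / 16 <= p * (a - b)%:R * (15 / 16) + p * (15 / 16).
  have := ler_wpM2l (ltW p0) hm; lra.
set m := (a - b)%:R in hm htau *.
have hm30 : 63 <= m by lra.
have pm : 63 * p <= p * m by rewrite mulrC ler_pM2l.
have htau' : p * m / 32 <= p * m - (3 / 4 * p * X * s + p * X * s / 8 + p * X * s / 16) by lra.
have htau'' : 3 / 4 * p * X * s + p * X * s / 8 + p * X * s / 16 < p * m by lra.
apply: (le_trans (binomE_biased (ltW p0) p1 hba s0 hbs y0 hMy htau'')).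
rewrite -/m.
have : m / (4 * (p * m - (3 / 4 * p * X * s + p * X * s / 8 + p * X * s / 16)) ^+ 2) <=
    (32 * M%:R)^-1.
  set D := p * m - _ in htau' *.
  have D0 : 0 < D by lra.
  rewrite ler_pdivrMr ?mulr_gt0 ?exprn_gt0 // mulrC ler_pdivlMr ?mulr_gt0 //.
  have h1 : (p * m / 32) ^+ 2 <= D ^+ 2.
    by rewrite ler_sqr ?nnegrE //; [lra|exact: ltW].
  have h2 : 8 * 16 * (8 * 16 * M%:R) <= p ^+ 2 * (2 * m).
    apply: (le_trans hs2); rewrite -mulrA ler_wpM2l ?sqr_ge0 //; lra.
  have m0 : 0 <= m by lra.
  have := ler_wpM2r m0 h2; move: h1; rewrite !expr2; lra.
have -> : 9 / 32 / M%:R = 9 * (32 * M%:R)^-1 :> R by rewrite invfM mulrA.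
have -> : (4 * M%:R)^-1 = 8 * (32 * M%:R)^-1 :> R by field; lra.
lra.
Qed.

(** * Failure probability for a regular graph and a typical start *)

Lemma big_tupleS (R : nmodType) (T : finType) n (F : n.+1.-tuple T -> R) :
  \sum_(v : n.+1.-tuple T) F v =
  \sum_(x : T) \sum_(v : n.-tuple T) F [tuple of x :: v].
Proof.
rewrite pair_bigA /= (reindex (fun q : T * n.-tuple T => [tuple of q.1 :: q.2])) //=.
exists (fun v => (thead v, [tuple of behead v])) => [[x v] _|v _] /=.
  by rewrite theadE; congr (_, _); apply: val_inj.
by rewrite [RHS]tuple_eta.
Qed.

Section Quenched.
Context (R : realType) (n : nat).
Local Notation N := n.+1.
Implicit Types (G : sgraph n.+1) (A : {set 'I_n.+1}).

Definition trivial_part A : bool := (A == finset.set0) || (A == finset.setT).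

Lemma fail_prob_tuple G T A c :
  fail_prob R G T A c = (N%:R ^+ T)^-1 * \sum_(v : T.-tuple 'I_n.+1)
    (greedy_search G A (fun t => nth ord0 v t) c T != finset.setT)%:R.
Proof.
elim: T A c => [|T IH] A c.
  rewrite expr0 invr1 mul1r (eq_bigr (fun=> (A != finset.setT)%:R)) // sumr_const.
  by rewrite card_tuple expn0.
rewrite big_tupleS /= exprS invfM -mulrA; congr (_ * _).
rewrite mulr_sumr; apply: eq_bigr => x _; rewrite IH; congr (_ * _).
by apply: eq_bigr => v _; rewrite -[greedy_step _ _ _ _ in RHS]/(greedy_search _ _ _ _ T.+1) greedy_searchS.
Qed.

(** The search ends in neither of the two trivial sets; unlike fail_prob this is
    symmetric under complement. *)
Definition nontrivial_prob G T A c : R := (N%:R ^+ T)^-1 * \sum_(v : T.-tuple 'I_n.+1)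
  (~~ trivial_part (greedy_search G A (fun t => nth ord0 v t) c T))%:R.

Lemma nontrivial_prob_le G T A c : nontrivial_prob G T A c <= fail_prob R G T A c.
Proof.
rewrite fail_prob_tuple ler_wpM2l ?invr_ge0 ?exprn_ge0 //.
apply: ler_sum => v _; rewrite ler_nat /trivial_part.
by case: (_ == finset.setT); rewrite ?orbT // leq_b1.
Qed.

Lemma nontrivial_prob_compl G T A c :
  nontrivial_prob G T (~: A) c = nontrivial_prob G T A c.
Proof.
congr (_ * _); apply: eq_bigr => v _; rewrite greedy_search_compl /trivial_part.
set B := greedy_search _ _ _ _ _.
have -> : (~: B == finset.set0) = (B == finset.setT).
  by rewrite -finset.setCT (inj_eq (inv_inj (@finset.setCK _))).
have -> : (~: B == finset.setT) = (B == finset.set0).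
  by rewrite -finset.setC0 (inj_eq (inv_inj (@finset.setCK _))).
by rewrite orbC.
Qed.

Definition majority A : {set 'I_n.+1} := if (N <= 2 * #|A|)%N then A else ~: A.

Lemma card_majority A : 2 * #|majority A|%:R - N%:R = `|2 * #|A|%:R - N%:R| :> R.
Proof.
rewrite /majority; case: ifPn => [h|]; last rewrite -ltnNge => h.
  have h' : 0 <= 2 * #|A|%:R - N%:R :> R by rewrite subr_ge0 -natrM ler_nat.
  by rewrite ger0_norm.
have h' : 2 * #|A|%:R - N%:R < 0 :> R by rewrite subr_lt0 -natrM ltr_nat.
by rewrite cardC_real ltr0_norm //; ring.
Qed.

Lemma nontrivial_prob_majority G T A c :
  nontrivial_prob G T (majority A) c = nontrivial_prob G T A c.
Proof. by rewrite /majority; case: ifP => // _; rewrite nontrivial_prob_compl. Qed.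

Lemma expRN_le_inv (x : R) : 0 < x -> expR (- x) <= x^-1.
Proof.
move=> x0; rewrite expRN lef_pV2 ?posrE ?expR_gt0 //.
by apply: le_trans (expR_ge1Dx x); rewrite lerDr.
Qed.

Lemma mul_expRN_le (k x : R) : 0 < k -> 0 < x -> x * expR (- (k * x)) <= 4 / k ^+ 2 / x.
Proof.
move=> k0 x0.
have y0 : 0 < k * x / 2 by rewrite !mulr_gt0.
have -> : - (k * x) = - (k * x / 2) + - (k * x / 2) by field.
have h := expRN_le_inv y0.
rewrite expRD; apply: (@le_trans _ _ (x * ((k * x / 2)^-1 * (k * x / 2)^-1))).
  by rewrite ler_pM2l // ler_pM ?expR_ge0.
rewrite le_eqVlt; apply/orP; left; apply/eqP; field; by rewrite !lt0r_neq0.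
Qed.

Lemma nontrivial_prob_regular (p X b K' lam s : R) (M L : nat) G A c :
  0 < p -> p <= 1 -> 0 < X -> X <= 1 -> 0 < b -> b <= p / 16 -> s ^+ 2 = N%:R -> 4 <= s ->
  b * K' = (20 / p) ^+ 2 + 1 ->
  0 < lam -> 8 * 16 * (lam * K') <= p * X * b ->
  12 * 16 <= lam * p * X * b * s -> 16 <= X * s -> 2 * K' <= b * s ->
  4 * N%:R <= b * L%:R :> R -> 4 * b <= (8 * M%:R)^-1 ->
  jumbled p (4 * s)^-1 G -> jumbled p lam G -> min_degree_ok p G ->
  X * s <= `|2 * #|A|%:R - N%:R| -> `|2 * #|A|%:R - N%:R| <= b * N%:R ->
  #|[set u | (advantage R G (majority A) u <= 3 / 4 * p * X * s)%R]|%:R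
     <= (2^-1 - (8 * M%:R)^-1) * N%:R :> R ->
  nontrivial_prob G (L + N ^ 2) A c <=
    expR (- (b / 9 * (X * s / 4))) + N%:R * expR (- N%:R).
Proof.
move=> p0 p1 X0 X1 b0 bp sN s4 hK lam0 hlam h1 h2 h3 hL hM hJ1 hJ2 hd hA1 hA2 hpop.
have s0 : 0 < s by lra.
have NR : 0 < N%:R :> R by rewrite ltr0n.
have b1 : b <= 1 by lra.
rewrite -nontrivial_prob_majority.
rewrite -card_majority in hA1 hA2.
set A0 := majority A in hA1 hA2 hpop *.
apply: (le_trans (nontrivial_prob_le _ _ _ _)).
have N4 : (4 <= N)%N.
  rewrite -(ler_nat R) -sN expr2; nra.
have hs1 : 1 <= s by lra.
have hpop' : #|[set u | (advantage R G A0 u <= 3 / 4 * p * X * s)%R]|%:R <=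
    (2^-1 - 4 * b) * N%:R.
  apply: (le_trans hpop); rewrite ler_pM2r //; lra.
have x0 : 0 < X * s / 4 by lra.
have hend A' : #|~: A'|%:R <= p / 8 * N%:R -> unattracted G A' = finset.set0.
  by move=> hA'; apply: unattracted_small_complement hA'.
have hdrift t A' : (#|A' :\: A0| + #|A0 :\: A'| <= t)%N ->
     #|A0|%:R + b / 2 * t%:R - X * s / 4 <= #|A'|%:R -> p / 8 * N%:R < #|~: A'|%:R ->
     #|unattracted G A'|%:R + b * N%:R <= #|~: A'|%:R.
  move=> q1 q2 q3.
  by apply: (drift_of_regular p0 X0 b0 bp sN hs1 hK lam0 hlam h1 h2 h3 hJ1 hJ2 hA1 hA2 hpop' q1 q2 q3).
(* b L / 2 >= 2 N leaves room, since #|A0| >= 0 and X s <= N. *)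
have hbar : N%:R < #|A0|%:R + b / 2 * L%:R - X * s / 4.
  have : X * s <= 1 * N%:R.
    apply: ler_pM => //; [exact: ltW|exact: ltW|].
    by rewrite -sN expr2 ler_peMl // ltW.
  lra.
have h0 : (#|A0 :\: A0| + #|A0 :\: A0| <= 0)%N by rewrite finset.setDv cards0.
have := fail_prob_drift (isT : (0 < N)%N) b0 b1 erefl x0 hend hdrift hbar
   (L' := N ^ 2) c (add0n _) (leq0n _) h0.
rewrite subrr mulr0 subr0 add0r => h; apply: (le_trans h).
rewrite lerD2l ler_pM2l //.
have i1 : 0 <= 1 - N%:R^-1 :> R by rewrite subr_ge0 invf_le1 // ler1n.
have -> : - N%:R = (N ^ 2)%:R * - N%:R^-1 :> R.
  by rewrite natrX expr2 mulrN mulfK // lt0r_neq0.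
rewrite expRM_natl lerXn2r ?nnegrE ?expR_ge0 //.
exact: expR_ge1Dx.
Qed.

End Quenched.

(** * Total failure probability *)

Section TotalFailure.
Context (R : realType) (p : R) (n : nat).
Local Notation N := n.+1.

Lemma exchange_bern_E (I J : finType) (q q' : R)
    (F : {ffun I -> bool} -> {ffun J -> bool} -> R) :
  bern_E q (fun g => bern_E q' (F g)) = bern_E q' (fun a => bern_E q (F^~ a)).
Proof.
rewrite /bern_E; under eq_bigr do rewrite mulr_sumr.
rewrite exchange_big; apply: eq_bigr => a _; rewrite mulr_sumr.
by apply: eq_bigr => g _; rewrite mulrCA.
Qed.

Definition no_isolated (G : sgraph N) : bool := [forall u, 0 < deg_in G finset.setT u]%N.

(** Without isolated vertices the trivial partitions are absorbing, so that being
    trivial at time T means termination. *)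
Definition search_ok T (g : {ffun vpair N -> bool}) (a : {ffun 'I_N -> bool})
    (c : T.-tuple bool) (v : T.-tuple 'I_N) : bool :=
  no_isolated (graph_of g) &&
  trivial_part (greedy_search (graph_of g) (chosen_set a) (fun t => nth ord0 v t)
    (fun t => nth false c t) T).

Definition total_fail T : R :=
  bern_E p (fun g => bern_E 2^-1 (fun a => (2 ^+ T)^-1 * \sum_c
    ((N%:R ^+ T)^-1 * \sum_v (~~ search_ok g a (T := T) c v)%:R))).

Lemma min_degree_no_isolated G : 0 < p -> (4 <= N)%N -> min_degree_ok p G -> no_isolated G.
Proof.
move=> p_gt0 N4 /forallP h; apply/forallP => u; rewrite -(ltr_nat R).
apply: le_lt_trans (h u); rewrite -[N.-1]/n.
have h1 : p * 4 <= p * N%:R by apply: ler_wpM2l; [exact: ltW|rewrite ler_nat].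
move: h1 p_gt0; rewrite -[N%:R]natr1; lra.
Qed.

(** Union bound over the ways in which the graph or the initial partition can be
    atypical; in all other cases nontrivial_prob_regular applies. *)
Lemma total_fail_le (X b K' lam s : R) (M L : nat) :
  0 < p -> p <= 1 -> 0 < X -> X <= 1 -> 0 < b -> b <= p / 16 -> s ^+ 2 = N%:R -> 4 <= s ->
  b * K' = (20 / p) ^+ 2 + 1 ->
  0 < lam -> lam <= 4^-1 -> 8 * 16 * (lam * K') <= p * X * b ->
  12 * 16 <= lam * p * X * b * s -> 64 <= X * s -> 2 * K' <= b * s ->
  4 * N%:R <= b * L%:R :> R -> 4 * b <= (8 * M%:R)^-1 ->
  32 < M%:R * (p * X) -> 8 * 16 * (8 * 16 * M%:R) <= p ^+ 2 * X * s ->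
  total_fail (L + N ^ 2) <=
    2 * expR (- N%:R) + 2 * expR (- N%:R) + N%:R * expR (- (p ^+ 2 / 128 * N%:R)) +
    (X + s^-1) + 2 * expR (- (b ^+ 2 / 32 * N%:R)) +
    (N%:R^-1 + 40 / (p * X * s)) * (64 * M%:R ^+ 2) +
    (expR (- (b / 9 * (X * s / 4))) + N%:R * expR (- N%:R)).
Proof.
move=> p_gt0 p_le1 X0 X1 b0 bp sN s4 hK lam0 lam1 hlam h1 h2 h3 hL hM hM1 hM2.
have s0 : 0 < s by lra.
have b1 : b <= 1 by move: p_le1; lra.
have half0 : 0 <= 2^-1 :> R by rewrite invr_ge0.
have half1 : 2^-1 <= 1 :> R by rewrite invf_le1 // ler1n.
have N4 : (4 <= N)%N by rewrite -(ler_nat R) -sN expr2; nra.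
pose B := expR (- (b / 9 * (X * s / 4))) + N%:R * expR (- N%:R).
have B0 : 0 <= B by rewrite addr_ge0 ?mulr_ge0 ?expR_ge0.
pose J1 (g : {ffun vpair N -> bool}) : R := (~~ jumbled p (4 * s)^-1 (graph_of g))%:R.
pose J2 (g : {ffun vpair N -> bool}) : R := (~~ jumbled p lam (graph_of g))%:R.
pose D (g : {ffun vpair N -> bool}) : R := (~~ min_degree_ok p (graph_of g))%:R.
pose A1 (a : {ffun 'I_N -> bool}) : R := (`|2 * #|chosen_set a|%:R - N%:R| < X * s)%R%:R.
pose A2 (a : {ffun 'I_N -> bool}) : R := (b * N%:R < `|2 * #|chosen_set a|%:R - N%:R|)%R%:R.
pose Q (g : {ffun vpair N -> bool}) (a : {ffun 'I_N -> bool}) : R :=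
  (X * s <= `|2 * #|chosen_set a|%:R - N%:R|)%R%:R *
  (((2^-1 - (8 * M%:R)^-1 : R) * N%:R : R) <
    #|[set u | (advantage R (graph_of g) (majority (chosen_set a)) u <= 3 / 4 * p * X * s)%R]|%:R)%R%:R.
have inner g a : (2 ^+ (L + N ^ 2))^-1 * \sum_c
    ((N%:R ^+ (L + N ^ 2))^-1 * \sum_v (~~ search_ok g a (T := (L + N ^ 2)%N) c v)%:R) <=
    J1 g + J2 g + D g + A1 a + A2 a + Q g a + B.
  set T := (L + N ^ 2)%N.
  have two0 : 0 < 2 ^+ T :> R by rewrite exprn_gt0.
  have avg (C : R) : \sum_(c : T.-tuple bool) C = 2 ^+ T * C.
    by rewrite sumr_const card_tuple card_bool -natrX mulr_natl.
  rewrite ler_pdivrMl // -avg; apply: ler_sum => c _.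
  have pos : [/\ 0 <= J1 g, 0 <= J2 g, 0 <= D g, 0 <= A1 a & 0 <= A2 a] by [].
  have Q0 : 0 <= Q g a by rewrite mulr_ge0.
  have Nx : 0 < N%:R ^+ T :> R by rewrite exprn_gt0 // ltr0n.
  have le1 : (N%:R ^+ T)^-1 * \sum_v (~~ search_ok g a c v)%:R <= 1 :> R.
    rewrite ler_pdivrMl // mulr1.
    apply: (@le_trans _ _ (\sum_(v : T.-tuple 'I_N) 1)).
      by apply: ler_sum => v _; case: (~~ _).
    by rewrite sumr_const card_tuple card_ord natrX.
  case: pos => p1 p2 p3 p4 p5.
  have [hJ1|hJ1] := boolP (jumbled p (4 * s)^-1 (graph_of g)); last first.
    by apply: (le_trans le1); have -> : J1 g = 1; [rewrite /J1 hJ1|move: p1 p2 p3 p4 p5 Q0 B0; clear; lra].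
  have [hJ2|hJ2] := boolP (jumbled p lam (graph_of g)); last first.
    by apply: (le_trans le1); have -> : J2 g = 1; [rewrite /J2 hJ2|move: p1 p2 p3 p4 p5 Q0 B0; clear; lra].
  have [hD|hD] := boolP (min_degree_ok p (graph_of g)); last first.
    by apply: (le_trans le1); have -> : D g = 1; [rewrite /D hD|move: p1 p2 p3 p4 p5 Q0 B0; clear; lra].
  have [hA1|hA1] := ltrP (`|2 * #|chosen_set a|%:R - N%:R|) (X * s).
    by apply: (le_trans le1); have -> : A1 a = 1; [rewrite /A1 hA1|move: p1 p2 p3 p4 p5 Q0 B0; clear; lra].
  have [hA2|hA2] := ltrP (b * N%:R) (`|2 * #|chosen_set a|%:R - N%:R|).
    by apply: (le_trans le1); have -> : A2 a = 1; [rewrite /A2 hA2|move: p1 p2 p3 p4 p5 Q0 B0; clear; lra].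
  have [hQ|hQ] := ltrP ((2^-1 - (8 * M%:R)^-1 : R) * N%:R)
    #|[set u | (advantage R (graph_of g) (majority (chosen_set a)) u <= 3 / 4 * p * X * s)%R]|%:R.
    by apply: (le_trans le1); have -> : Q g a = 1; [rewrite /Q hA1 hQ mulr1|move: p1 p2 p3 p4 p5 Q0 B0; clear; lra].
  have h2' : 16 <= X * s by apply: le_trans h2; rewrite ler_nat.
  have := @nontrivial_prob_regular R n p X b K' lam s M L (graph_of g) (chosen_set a)
    (fun t => nth false c t) p_gt0 p_le1 X0 X1 b0 bp sN s4 hK lam0 hlam h1 h2' h3 hL hM
    hJ1 hJ2 hD hA1 hA2 hQ.
  rewrite -/B /nontrivial_prob -/T.
  under [X in _ * X <= _ -> _]eq_bigr => v _ do
    rewrite -[~~ _]/(~~ (true && _)) -(min_degree_no_isolated p_gt0 N4 hD).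
  by move=> h; apply: (le_trans h); rewrite lerDr !addr_ge0.
apply: (@le_trans _ _ (bern_E p (fun g => bern_E 2^-1 (fun a =>
   J1 g + J2 g + D g + A1 a + A2 a + Q g a + B)))).
  apply: ler_bern_E; [exact: ltW|exact: p_le1|move=> g].
  by apply: ler_bern_E => // a; apply: inner.
have -> : bern_E p (fun g => bern_E 2^-1 (fun a => J1 g + J2 g + D g + A1 a + A2 a + Q g a + B)) =
  bern_E p J1 + bern_E p J2 + bern_E p D + bern_E 2^-1 A1 + bern_E 2^-1 A2 +
  bern_E 2^-1 (fun a => bern_E p (Q^~ a)) + B.
  (* J1, J2 and D depend on the graph only, A1 and A2 on the initial partition. *)
  transitivity (bern_E p (fun g => J1 g + J2 g + D g + bern_E 2^-1 A1 + bern_E 2^-1 A2 +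
     bern_E 2^-1 (Q g) + B)).
    by congr bern_E; apply: funext => g; rewrite !bern_ED !bern_E_cst.
  by rewrite !bern_ED !bern_E_cst (exchange_bern_E _ _ Q).
have p0 := ltW p_gt0.
have eJ1 : bern_E p J1 <= 2 * expR (- N%:R).
  apply: bern_E_not_jumbled => //; first by rewrite invr_gt0 mulr_gt0.
  have e4 : 4 <= 4 * s by move: s4; clear; lra.
  by rewrite lef_pV2 ?posrE ?mulr_gt0.
have eJ2 : bern_E p J2 <= 2 * expR (- N%:R) by apply: bern_E_not_jumbled.
have eD : bern_E p D <= N%:R * expR (- (p ^+ 2 / 128 * N%:R)) by apply: bern_E_not_min_degree_ok.
have eA1 : bern_E 2^-1 A1 <= X + s^-1 by apply: initial_spread => //; exact: ltW.
have eA2 : bern_E 2^-1 A2 <= 2 * expR (- (b ^+ 2 / 32 * N%:R)) by apply: initial_balance.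
have eQ : bern_E 2^-1 (fun a => bern_E p (Q^~ a)) <=
    (N%:R^-1 + 40 / (p * X * s)) * (64 * M%:R ^+ 2).
  rewrite -[leRHS](bern_E_cst ('I_N) 2^-1); apply: ler_bern_E => // a.
  rewrite bern_EZ; case: (lerP (X * s) `|2 * #|chosen_set a|%:R - N%:R|) => hA; last first.
    have pXs0 : 0 <= p * X * s by rewrite !mulr_ge0 // ltW.
    rewrite mul0r; apply: mulr_ge0; last by apply: mulr_ge0; [exact: ler0n|exact: sqr_ge0].
    by apply: addr_ge0; [rewrite invr_ge0 ler0n|apply: divr_ge0 pXs0; exact: ler0n].
  rewrite mul1r; apply: population_biased => //.
  by rewrite card_majority.
by rewrite -/B; do !apply: lerD.
Qed.

End TotalFailure.

(** The parameters are chosen in the order X, M, b, K', lam; then every error term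
    apart from X is at most a constant divided by s. *)
Lemma total_fail_small (R : realType) (p eps : R) : 0 < p -> p <= 1 -> 0 < eps ->
  exists n0 : nat, forall n, (n0 <= n)%N -> exists T, total_fail p n T <= eps.
Proof.
move=> p0 p1 eps0.
pose X : R := Num.min 1 (eps / 2).
have X0 : 0 < X by rewrite lt_min ltr01 divr_gt0.
have X1 : X <= 1 by rewrite ge_min lexx.
have Xeps : X <= eps / 2 by rewrite ge_min lexx orbT.
have pX0 : 0 < p * X by rewrite mulr_gt0.
pose M := (Num.trunc (32 / (p * X))).+1.
have M0 : 0 < M%:R :> R by [].
have M1 : 1 <= M%:R :> R by rewrite ler1n.
have hM1 : 32 < M%:R * (p * X) by rewrite -ltr_pdivrMr // truncnS_gt.
pose b : R := p / (32 * M%:R).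
have M32 : 0 < 32 * M%:R :> R by rewrite mulr_gt0.
have b0 : 0 < b by rewrite divr_gt0.
have bp : b <= p / 16.
  by rewrite ler_pM2l // lef_pV2 ?posrE //; lra.
have b1 : b <= 1 by lra.
have hbM : 4 * b <= (8 * M%:R)^-1.
  rewrite -[leRHS]mul1r ler_pdivlMr ?mulr_gt0 //.
  have -> : 4 * b * (8 * M%:R) = p by rewrite /b; field; rewrite lt0r_neq0.
  exact: p1.
clearbody M b X.
pose K' : R := ((20 / p) ^+ 2 + 1) / b.
have hK : b * K' = (20 / p) ^+ 2 + 1 by rewrite /K' mulrC divfK // lt0r_neq0.
have K1 : 1 <= K'.
  rewrite -(ler_pM2l b0) hK mulr1; apply: (le_trans b1).
  by rewrite lerDr sqr_ge0.
clearbody K'.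
have K0 : 0 < K' by lra.
have K128 : 0 < 8 * 16 * K' by rewrite mulr_gt0.
pose lam : R := p * X * b / (8 * 16 * K').
have lam0 : 0 < lam by rewrite divr_gt0 ?mulr_gt0.
have hlam : 8 * 16 * (lam * K') <= p * X * b.
  by rewrite mulrCA divfK // lt0r_neq0.
have lam1 : lam <= 4^-1.
  rewrite ler_pdivrMr //.
  have : p * X * b <= 1 by rewrite !mulr_ile1 ?mulr_ge0 // ?ltW.
  lra.
clearbody lam.
pose kap : R := p ^+ 2 / 128.
have kap0 : 0 < kap by rewrite divr_gt0 ?exprn_gt0.
(* c1 to c4 are the constants of the error terms in total_fail_le. *)
pose c1 : R := 4 / kap ^+ 2.
pose c2 : R := (b ^+ 2 / 32)^-1.
pose c3 : R := (1 + 40 / (p * X)) * (64 * M%:R ^+ 2).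
pose c4 : R := (b * X / 36)^-1.
pose C : R := 4 + c1 + 1 + 2 * c2 + c3 + c4 + 4.
have C0 : 0 <= C.
  have c10 : 0 <= c1 by apply: divr_ge0; [exact: ler0n|exact: sqr_ge0].
  have c20 : 0 <= c2 by rewrite invr_ge0; apply: divr_ge0; [exact: sqr_ge0|exact: ler0n].
  have c30 : 0 <= c3.
    apply: mulr_ge0; last by apply: mulr_ge0; [exact: ler0n|exact: sqr_ge0].
    by apply: addr_ge0; [exact: ler01|apply: divr_ge0; [exact: ler0n|exact: ltW]].
  have c40 : 0 <= c4.
    by rewrite invr_ge0; apply: divr_ge0; [rewrite mulr_ge0 // ltW|exact: ler0n].
  by rewrite /C !addr_ge0 // mulr_ge0.
pose lpXb := lam * p * X * b.
have lpXb0 : 0 < lpXb by rewrite !mulr_gt0.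
have ppX0 : 0 < p ^+ 2 * X by rewrite mulr_gt0 ?exprn_gt0.
pose s0 : R := 4 + 12 * 16 / lpXb + 64 / X + 2 * K' / b +
  8 * 16 * (8 * 16 * M%:R) / (p ^+ 2 * X) + 2 * C / eps.
have g1 : 0 <= 12 * 16 / lpXb by rewrite divr_ge0 // ltW.
have g2 : 0 <= 64 / X by rewrite divr_ge0 // ltW.
have g3 : 0 <= 2 * K' / b by rewrite divr_ge0 ?mulr_ge0 // ltW.
have g4 : 0 <= 8 * 16 * (8 * 16 * M%:R) / (p ^+ 2 * X).
  by rewrite divr_ge0 ?mulr_ge0 // ?ltW // exprn_ge0 // ltW.
have g5 : 0 <= 2 * C / eps by rewrite divr_ge0 ?mulr_ge0 // ltW.
have s00 : 0 <= s0 by rewrite /s0 !addr_ge0.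
exists (Num.trunc (s0 ^+ 2)).+1 => n hn.
pose s : R := Num.sqrt n.+1%:R.
have sN : s ^+ 2 = n.+1%:R by rewrite sqr_sqrtr.
have hs : s0 <= s.
  rewrite -ler_sqr ?nnegrE ?sqrtr_ge0 // sN; apply: ltW.
  apply: (lt_le_trans (truncnS_gt _)).
  by rewrite ler_nat ltnW.
clearbody s.
have [q1 q2 q3 q4 q5] : [/\ 12 * 16 / lpXb <= s, 64 / X <= s, 2 * K' / b <= s,
    8 * 16 * (8 * 16 * M%:R) / (p ^+ 2 * X) <= s & 2 * C / eps <= s].
  move: hs g1 g2 g3 g4 g5; rewrite /s0; clear.
  move: (_ / lpXb) (64 / _) (_ / b) (_ / (p ^+ 2 * X)) (_ / eps) => *; split; lra.
have s4 : 4 <= s by move: hs g1 g2 g3 g4 g5; rewrite /s0; lra.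
clear g1 g2 g3 g4 g5 hs s00.
rewrite ler_pdivrMr // in q1; rewrite ler_pdivrMr // in q2.
rewrite ler_pdivrMr // in q3; rewrite ler_pdivrMr // in q4.
rewrite ler_pdivrMr // in q5.
pose L := (Num.trunc (4 * n.+1%:R / b : R)).+1.
have hL : 4 * n.+1%:R <= b * L%:R :> R.
  by rewrite [leRHS]mulrC -ler_pdivrMr // ltW // truncnS_gt.
clearbody L.
exists (L + n.+1 ^ 2)%N.
have spos : 0 < s by lra.
have si0 : 0 < s^-1 by rewrite invr_gt0.
have h1 : 12 * 16 <= lam * p * X * b * s by rewrite [leRHS]mulrC.
have h2 : 64 <= X * s by rewrite [leRHS]mulrC.
have h3 : 2 * K' <= b * s by rewrite [leRHS]mulrC.
have h4 : 8 * 16 * (8 * 16 * M%:R) <= p ^+ 2 * X * s by rewrite [leRHS]mulrC.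
apply: (le_trans (total_fail_le p0 p1 X0 X1 b0 bp sN s4 hK lam0 lam1 hlam h1 h2 h3 hL hbM hM1 h4)).
have NR : 0 < n.+1%:R :> R by rewrite ltr0n.
have Ns : n.+1%:R^-1 <= s^-1.
  by rewrite lef_pV2 ?posrE // -sN expr2 ler_peMl ?ltW //; lra.
have e1 : expR (- n.+1%:R) <= s^-1 by apply: le_trans (expRN_le_inv NR) Ns.
have e2 (k : R) : 0 < k -> n.+1%:R * expR (- (k * n.+1%:R)) <= 4 / k ^+ 2 * s^-1.
  move=> k0; apply: (le_trans (mul_expRN_le k0 NR)); apply: ler_wpM2l => //.
  by rewrite divr_ge0 // exprn_ge0 // ltW.
have e3 : expR (- (b ^+ 2 / 32 * n.+1%:R)) <= (b ^+ 2 / 32)^-1 * s^-1.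
  have k0 : 0 < b ^+ 2 / 32 by rewrite divr_gt0 ?exprn_gt0.
  apply: (le_trans (expRN_le_inv (mulr_gt0 k0 NR))); rewrite invfM.
  by apply: ler_wpM2l => //; rewrite invr_ge0 ltW.
have e4 : expR (- (b / 9 * (X * s / 4))) <= (b * X / 36)^-1 * s^-1.
  have k0 : 0 < b * X / 36 by rewrite divr_gt0 ?mulr_gt0.
  have -> : b / 9 * (X * s / 4) = b * X / 36 * s by field.
  apply: (le_trans (expRN_le_inv (mulr_gt0 k0 spos))); by rewrite invfM.
have e5 : n.+1%:R * expR (- n.+1%:R) <= 4 * s^-1.
  by have := e2 1 ltr01; rewrite mul1r expr1n divr1.
have e6 : (n.+1%:R^-1 + 40 / (p * X * s)) * (64 * M%:R ^+ 2) <=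
    (1 + 40 / (p * X)) * (64 * M%:R ^+ 2) * s^-1.
  rewrite [leRHS]mulrAC; apply: ler_wpM2r.
    by rewrite mulr_ge0 // exprn_ge0.
  have -> : (1 + 40 / (p * X)) * s^-1 = s^-1 + 40 / (p * X * s).
    by rewrite mulrDl mul1r [(p * X * s)^-1]invfM mulrA.
  by rewrite lerD2r.
have hC : C * s^-1 <= eps / 2.
  rewrite ler_pdivrMr //; lra.
have e7 := e2 kap kap0; rewrite {1}/kap in e7.
apply: (@le_trans _ _ (X + C * s^-1)); last first.
  by move: Xeps hC; clear; lra.
have -> : X + C * s^-1 = 2 * s^-1 + 2 * s^-1 + c1 * s^-1 + (X + s^-1) +
    2 * (c2 * s^-1) + c3 * s^-1 + (c4 * s^-1 + 4 * s^-1).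
  by rewrite /C; clearbody c1 c2 c3 c4; clear; ring.
have e1' : 2 * expR (- n.+1%:R) <= 2 * s^-1 by apply: ler_wpM2l.
have e3' : 2 * expR (- (b ^+ 2 / 32 * n.+1%:R)) <= 2 * (c2 * s^-1).
  by apply: ler_wpM2l.
by do !apply: lerD.
Qed.

(** * Trivial partitions are absorbing *)

Section Absorbing.
Context (n : nat) (G : sgraph n.+1).
Implicit Types (A : {set 'I_n.+1}).

(** With every vertex in A, all neighbours are in A and there is at least one. *)
Lemma greedy_step_trivial A v c : no_isolated G -> trivial_part A ->
  greedy_step G A v c = A.
Proof.
move=> hG hA.
have full : greedy_step G finset.setT v c = finset.setT.
  rewrite greedy_step_good ?finset.setUT // inE -ltnNge finset.setCT.
  by rewrite /deg_in [X in (X < _)%N]big_set0; move/forallP: hG => /(_ v).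
case/orP: hA => /eqP -> //.
by rewrite -finset.setCT greedy_step_compl full.
Qed.

Lemma trivial_terminates A v c T : no_isolated G ->
  trivial_part (greedy_search G A v c T) -> terminates_trivially G A v c.
Proof.
move=> hG hT; exists T; split.
  by case/orP: (hT) => /eqP ->; [left|right]; rewrite ?finset.setCT.
move=> t; elim: t => [|t IH]; first by rewrite leqn0 => /eqP ->.
rewrite leq_eqVlt => /orP[/eqP -> //|]; rewrite ltnS => /IH {}IH.
by rewrite /= IH greedy_step_trivial.
Qed.

Lemma eq_greedy_search A v v' c c' t :
  (forall i, (i < t)%N -> v i = v' i) -> (forall i, (i < t)%N -> c i = c' i) ->
  greedy_search G A v c t = greedy_search G A v' c' t.
Proof.
elim: t => //= t IH hv hc; rewrite hv // hc // IH // => i it.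
  by apply: hv; apply: ltnW.
by apply: hc; apply: ltnW.
Qed.

End Absorbing.

(** * From the random model to finite sums *)

Lemma sgraph_eq (N : nat) (G G' : sgraph N) : (forall u w, G u w = G' u w) -> G = G'.
Proof.
case: G => a sa ia; case: G' => a' sa' ia' /= h.
have e : a = a' by apply: funext => u; apply: funext => w; exact: h.
by move: sa ia; rewrite e => sa ia; congr SGraph; exact: Prop_irrelevance.
Qed.

Lemma graph_of_adj (N : nat) (G : sgraph N) :
  graph_of [ffun e : vpair N => G (val e).1 (val e).2] = G.
Proof.
have lt (u w : 'I_N) : (u < w)%N -> graph_of [ffun e : vpair N => G (val e).1 (val e).2] u w = G u w.
  move=> h; pose e : vpair N := Sub (u, w) h.
  by rewrite -[u]/((val e).1) -[w]/((val e).2) graph_of_vpair ffunE.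
apply: sgraph_eq => u w; case: (ltngtP u w) => h; first exact: lt.
  by rewrite adj_sym lt // adj_sym.
by rewrite (val_inj h) !adj_irrefl.
Qed.

Local Open Scope classical_set_scope.
Local Open Scope ring_scope.

Section FiniteValued.
Context (R : realType) (d : measure_display) (T : measurableType d) (P : probability T R).

(** A variable with finitely many values and measurable fibres is measurable, and
    its law is the sum over its values. *)
Lemma finite_valued (S : finType) (Y : T -> S) (B : pred S) :
  (forall x, measurable (Y @^-1` [set x])) ->
  measurable [set w | B (Y w)] /\
  P [set w | B (Y w)] = (\sum_(x | B x) P (Y @^-1` [set x]))%E.
Proof.
move=> mY.
have H (r : seq S) : uniq r -> measurable [set w | Y w \in r] /\
    P [set w | Y w \in r] = (\sum_(x <- r) P (Y @^-1` [set x]))%E.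
  elim: r => [_|x r IH /= /andP[xr /IH [mr Pr]]].
    have -> : [set w | Y w \in [::]] = set0 by apply/seteqP; split.
    by rewrite measure0 big_nil.
  have -> : [set w | Y w \in x :: r] = (Y @^-1` [set x]) `|` [set w | Y w \in r].
    apply/seteqP; split=> w /=; rewrite inE.
      by case/orP=> [/eqP|] ?; [left|right].
    by case=> [->|->]; rewrite ?eqxx ?orbT.
  split; first exact: measurableU.
  rewrite big_cons -Pr measureU //.
  apply/seteqP; split => // w [/= -> h].
  by rewrite h in xr.
have [m1 m2] := H (enum B) (enum_uniq _).
have e : [set w | Y w \in enum B] = [set w | B (Y w)].
  by apply/seteqP; split => w /=; rewrite mem_enum.
by rewrite -e; split => //; rewrite m2 big_enum.
Qed.

End FiniteValued.

Section ModelLaw.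
Context (R : realType) (p : R) (n : nat) (d : measure_display) (T : measurableType d)
  (P : probability T R) (G : T -> sgraph n.+1) (A0 : T -> {set 'I_n.+1})
  (v : nat -> T -> 'I_n.+1) (coin : nat -> T -> bool).
Hypothesis model : greedy_model p P G A0 v coin.
Local Notation N := n.+1.

Definition outcome L : finType :=
  (({ffun vpair N -> bool} * {ffun 'I_N -> bool}) *
   (L.-tuple bool * L.-tuple 'I_N))%type.

(** Everything that the first L steps of the search can see. *)
Definition observed L (w : T) : outcome L :=
  (([ffun e => G w (val e).1 (val e).2], [ffun i => i \in A0 w]),
   ([tuple coin t w | t < L], [tuple v t w | t < L])).

Definition prescribed L (x : outcome L) (s : source N) : set T :=
  match s with
  | EdgeAt e => [set w | G w (val e).1 (val e).2 = x.1.1 e]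
  | InitAt i => [set w | (i \in A0 w) = x.1.2 i]
  | PickAt t => [set w | v t w = nth ord0 x.2.2 t]
  | CoinAt t => [set w | coin t w = nth false x.2.1 t]
  end.

Definition sources L : seq (source N) :=
  [seq EdgeAt e | e <- enum (vpair N : finType)] ++
  [seq InitAt i | i <- enum 'I_N] ++
  [seq CoinAt N t | t <- iota 0 L] ++ [seq PickAt N t | t <- iota 0 L].

Lemma sources_uniq L : uniq (sources L).
Proof.
have hn (I J : Type) (f : I -> source N) (g : J -> source N) (r : seq I) (r' : seq J) :
    (forall i j, f i <> g j) -> ~~ has [in [seq f i | i <- r]] [seq g j | j <- r'].
  move=> h; apply/hasPn => s hs; apply/negP => hs'; move: hs hs'.
  elim: r' => //= j r' IH; rewrite inE => /orP[/eqP ->|] //.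
  by elim: r {IH} => //= i r IHr; rewrite inE => /orP[/eqP/esym /h|].
rewrite /sources !cat_uniq !has_cat !negb_or !hn // !map_inj_uniq ?iota_uniq //.
  by rewrite -!enumT !enum_uniq.
all: by move=> ? ? [].
Qed.

Lemma source_eventsP L (x : outcome L) s : source_events G A0 v coin s (prescribed x s).
Proof.
case: s => [e|i|t|t].
- by exists [set x.1.1 e] => //; rewrite setTI.
- by exists [set x.1.2 i] => //; rewrite setTI.
- by exists [set nth ord0 x.2.2 t] => //; rewrite setTI.
- by exists [set nth false x.2.1 t] => //; rewrite setTI.
Qed.

Lemma measurable_prescribed L (x : outcome L) s : measurable (prescribed x s).
Proof.
by case: model => -[h _] _ _ _ _; apply: (h s); apply: source_eventsP.
Qed.

Lemma mem_sources L s : (s \in sources L) =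
  match s with EdgeAt _ | InitAt _ => true | PickAt t | CoinAt t => (t < L)%N end.
Proof.
have hn (I : Type) (f : I -> source N) (r : seq I) s' : (forall i, f i <> s') ->
    s' \in [seq f i | i <- r] = false.
  move=> h; elim: r => //= i r IH; rewrite inE IH orbF.
  by apply/negbTE/eqP => /esym /h.
case: s => [e|i|t|t]; rewrite /sources !mem_cat.
- by rewrite map_f ?mem_enum.
- by rewrite (map_f (@InitAt N)) ?mem_enum ?orbT.
- rewrite (hn _ (@EdgeAt N)) // (hn _ (@InitAt N)) // (hn _ (@CoinAt N)) //=.
  by rewrite mem_map ?mem_iota // => ? ? [].
- rewrite (hn _ (@EdgeAt N)) // (hn _ (@InitAt N)) // (hn _ (@PickAt N)) // orbF /=.
  by rewrite mem_map ?mem_iota // => ? ? [].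
Qed.

Lemma observed_fiber L (x : outcome L) :
  observed L @^-1` [set x] = \bigcap_(s in [set` sources L]) prescribed x s.
Proof.
apply/seteqP; split => w.
  move=> <- s; rewrite [X in X -> _]/= mem_sources.
  case: s => [e|i|t|t] h; rewrite /prescribed /observed; cbn [fst snd]; rewrite /= ?ffunE //.
    have := tnth_mktuple (fun t : 'I_L => v t w) (Ordinal h).
    by rewrite (tnth_nth ord0) => ->.
  have := tnth_mktuple (fun t : 'I_L => coin t w) (Ordinal h).
  by rewrite (tnth_nth false) => ->.
move=> h.
have {}h s : s \in sources L -> prescribed x s w by move=> hs; apply: h.
case: x h => [[g a] [c u]] h; rewrite /observed /=; congr ((_, _), (_, _)).
- by apply/ffunP => e; rewrite ffunE; have := h (EdgeAt e); rewrite mem_sources; apply.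
- by apply/ffunP => i; rewrite ffunE; have := h (InitAt i); rewrite mem_sources; apply.
- apply: eq_from_tnth => t; rewrite tnth_mktuple (tnth_nth false).
  by have := h (CoinAt N t); rewrite mem_sources; apply.
- apply: eq_from_tnth => t; rewrite tnth_mktuple (tnth_nth ord0).
  by have := h (PickAt N t); rewrite mem_sources; apply.
Qed.

Lemma measurable_fiber L (x : outcome L) : measurable (observed L @^-1` [set x]).
Proof.
rewrite observed_fiber bigcap_seq; apply: bigsetI_measurable => s _.
exact: measurable_prescribed.
Qed.

Definition outcome_wt L (x : outcome L) : R :=
  bern_wt p x.1.1 * bern_wt 2^-1 x.1.2 * ((2 ^+ L)^-1 * (N%:R ^+ L)^-1).

Lemma prob_bool_event (q : R) (b : T -> bool) (z : bool) :
  measurable [set w | b w] -> P [set w | b w] = q%:E ->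
  P [set w | b w = z] = (if z then q else 1 - q)%:E.
Proof.
move=> mb hb; case: z => //.
have -> : [set w | b w = false] = ~` [set w | b w].
  by apply/seteqP; split => w /=; case: (b w).
by rewrite probability_setC // hb -EFinB.
Qed.

Lemma prod_EFin (I : Type) (r : seq I) (F : I -> R) (E : I -> \bar R) :
  (forall i, E i = (F i)%:E) -> (\prod_(i <- r) E i)%E = (\prod_(i <- r) F i)%:E.
Proof.
by move=> h; rewrite (eq_bigr _ (fun i _ => h i)) -(big_morph _ EFinM erefl).
Qed.

(** Mutual independence of the sources, applied to the list of those observed up to
    time L. *)
Lemma prob_fiber L (x : outcome L) : P (observed L @^-1` [set x]) = (outcome_wt x)%:E.
Proof.
case: (model) => -[hm hind] hedge hinit hpick hcoin.
rewrite observed_fiber hind ?sources_uniq //; last first.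
  by move=> s _; apply: source_eventsP.
have mtrue s (b : T -> bool) : source_events G A0 v coin s = events_of b ->
    measurable [set w | b w].
  move=> e; apply: (hm s); rewrite e; exists [set true] => //; rewrite setTI.
  by apply/seteqP; split.
rewrite !big_cat !big_map /=.
rewrite (@prod_EFin _ _ (fun e => if x.1.1 e then p else 1 - p)); last first.
  move=> e; apply: prob_bool_event; first exact: (mtrue (EdgeAt e)).
  by apply: hedge; apply: (valP e).
rewrite (@prod_EFin _ _ (fun i => if x.1.2 i then 2^-1 else 1 - 2^-1)); last first.
  by move=> i; apply: prob_bool_event; [exact: (mtrue (InitAt i))|exact: hinit].
rewrite (@prod_EFin _ _ (fun=> 2^-1)); last first.
  move=> t; have := prob_bool_event (nth false x.2.1 t) (mtrue (CoinAt N t) _ erefl) (hcoin t).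
  by move=> /= ->; case: ifP => // _; congr (_%:E); lra.
rewrite (@prod_EFin _ _ (fun=> N%:R^-1)); last by move=> t; apply: hpick.
rewrite -!EFinM /outcome_wt /bern_wt -!enumT !big_enum /= -!mulrA; congr ((_ * (_ * (_ * _)))%:E).
  by rewrite big_const_seq count_predT size_iota -exprVn iter_mulr_1.
by rewrite big_const_seq count_predT size_iota -exprVn iter_mulr_1.
Qed.

Lemma prob_observed L (B : pred (outcome L)) :
  measurable [set w | B (observed L w)] /\
  P [set w | B (observed L w)] = (\sum_(x | B x) outcome_wt x)%:E.
Proof.
have [h1 h2] := finite_valued P B (@measurable_fiber L).
split => //; rewrite h2 (eq_bigr _ (fun x _ => prob_fiber x)).
by rewrite -sumEFin.
Qed.

Definition outcome_ok L (x : outcome L) : bool := search_ok x.1.1 x.1.2 x.2.1 x.2.2.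

Lemma sum_outcome_total_fail L :
  \sum_(x : outcome L | ~~ outcome_ok x) outcome_wt x = total_fail p n L.
Proof.
rewrite big_mkcond /total_fail /bern_E.
transitivity (\sum_(x : outcome L) outcome_wt x * (~~ outcome_ok x)%:R).
  by apply: eq_bigr => x _; case: ifP; rewrite ?mulr1 ?mulr0.
rewrite -(pair_bigA _ (fun y z => outcome_wt ((y, z) : outcome L) *
   (~~ outcome_ok ((y, z) : outcome L))%:R)) /=.
rewrite -(pair_bigA _ (fun g a => \sum_z outcome_wt (((g, a), z) : outcome L) *
   (~~ outcome_ok (((g, a), z) : outcome L))%:R)) /=.
apply: eq_bigr => g _; rewrite mulr_sumr; apply: eq_bigr => a _.
rewrite -(pair_bigA _ (fun c u => outcome_wt (((g, a), (c, u)) : outcome L) *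
   (~~ outcome_ok (((g, a), (c, u)) : outcome L))%:R)) /=.
rewrite !mulr_sumr; apply: eq_bigr => c _; rewrite !mulr_sumr; apply: eq_bigr => u _.
by rewrite /outcome_wt /outcome_ok /= !mulrA.
Qed.

Let run t w := greedy_search (G w) (A0 w) (fun s => v s w) (fun s => coin s w) t.

Lemma run_observed L t w : (t <= L)%N ->
  run t w = greedy_search (graph_of (observed L w).1.1) (chosen_set (observed L w).1.2)
    (fun s => nth ord0 (observed L w).2.2 s) (fun s => nth false (observed L w).2.1 s) t.
Proof.
move=> tL; rewrite /run /observed /= graph_of_adj.
have -> : chosen_set [ffun i => i \in A0 w] = A0 w by apply/setP => i; rewrite inE ffunE.
apply: eq_greedy_search => i it; have iL := leq_trans it tL.
  have := tnth_mktuple (fun t : 'I_L => v t w) (Ordinal iL).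
  by rewrite (tnth_nth ord0) => ->.
have := tnth_mktuple (fun t : 'I_L => coin t w) (Ordinal iL).
by rewrite (tnth_nth false) => ->.
Qed.

Definition success_event : set T :=
  [set w | terminates_trivially (G w) (A0 w) (fun t => v t w) (fun t => coin t w)].

(** Termination is a countable combination of events that each depend on finitely
    many steps. *)
Lemma measurable_success : measurable success_event.
Proof.
have -> : success_event = \bigcup_t0 ([set w | trivial_part (run t0 w)] `&`
    \bigcap_(t in [set t | (t0 <= t)%N]) [set w | run t w = run t0 w]).
  apply/seteqP; split => w.
    move=> [t0 [h1 h2]]; exists t0 => //; split; last by move=> t /= /h2.
    rewrite /= /trivial_part; case: h1 => h1; first by rewrite -/(run t0 w) in h1; rewrite h1 eqxx.
    by rewrite -[run t0 w]finset.setCK [~: run t0 w]h1 finset.setC0 eqxx orbT.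
  move=> [t0 _ [/= h1 h2]]; exists t0; split; last by move=> t /h2.
  by case/orP: h1 => /eqP h1; [left|right; rewrite -/(run t0 w) h1 finset.setCT].
apply: bigcupT_measurable => t0.
pose final L t (x : outcome L) := greedy_search (graph_of x.1.1) (chosen_set x.1.2)
  (fun s => nth ord0 x.2.2 s) (fun s => nth false x.2.1 s) t.
have runE L t w : (t <= L)%N -> run t w = final L t (observed L w).
  exact: run_observed.
apply: measurableI.
  have [h _] := @prob_observed t0 (fun x => trivial_part (final t0 t0 x)).
  suff -> : [set w | trivial_part (run t0 w)] =
    [set w | trivial_part (final t0 t0 (observed t0 w))] by [].
  by apply/seteqP; split => w /=; rewrite (runE t0).
apply: bigcap_measurableType => t /= ht.
have [h _] := @prob_observed t (fun x => final t t x == final t t0 x).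
suff -> : [set w | run t w = run t0 w] =
  [set w | final t t (observed t w) == final t t0 (observed t w)] by [].
by apply/seteqP; split => w /=; rewrite (runE t t) // (runE t t0) // => /eqP.
Qed.

Lemma success_ge L : ((1 - total_fail p n L)%:E <= P success_event)%E.
Proof.
have [m1 e1] := prob_observed (fun x : outcome L => ~~ outcome_ok x).
rewrite sum_outcome_total_fail in e1.
rewrite EFinB -e1 -probability_setC //.
apply: le_measure; rewrite ?inE; [exact: measurableC|exact: measurable_success|].
move=> w /= /negP; rewrite negbK => /andP[h1 h2].
rewrite /= graph_of_adj in h1.
by apply: (@trivial_terminates _ _ _ _ _ L) => //; rewrite -/(run L w) (run_observed (L := L)).
Qed.

End ModelLaw.

Theorem corollary1p3 (R : realType) (p : R) (p_gt0 : 0 < p) (p_le1 : p <= 1)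
    (d : nat -> measure_display) (T : forall n, measurableType (d n))
    (P : forall n, probability (T n) R)
    (G : forall n, T n -> sgraph n.+1)
    (A0 : forall n, T n -> {set 'I_n.+1})
    (v : forall n, nat -> T n -> 'I_n.+1)
    (coin : forall n, nat -> T n -> bool)
    (model : forall n,
       greedy_model p (P n) (G n) (A0 n) (v n) (coin n)) :
  P n [set w | terminates_trivially (G n w) (A0 n w)
                 (fun t => v n t w) (fun t => coin n t w)]
    @[n --> \oo] --> 1%E.
Proof.
have le1 n : (P n [set w | terminates_trivially (G n w) (A0 n w)
    (fun t => v n t w) (fun t => coin n t w)] <= 1)%E.
  by apply: probability_le1; exact: (measurable_success (model n)).
have fin n : P n [set w | terminates_trivially (G n w) (A0 n w)
    (fun t => v n t w) (fun t => coin n t w)] \is a fin_num.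
  by apply: fin_num_measure; exact: (measurable_success (model n)).
apply/fine_cvgP; split; first by apply: nearW.
apply/cvgrPdist_le => eps eps0.
have [n0 h] := total_fail_small p_gt0 p_le1 eps0.
exists n0 => // n /= hn.
have [L hL] := h n hn.
have := success_ge (model n) L; have := le1 n.
rewrite /success_event -(fineK (fin n)) !lee_fin => h1 h2.
rewrite ger0_norm; first by lra.
by rewrite subr_ge0.
Qed.
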